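(* Let $M$ be a complete CAT($k$) space and $X\subseteq M$ compact; if $k>0$, assume $X$ is contained in a metric ball of radius $r<\frac{\pi}{2\sqrt{k}}$. Assume that all barycenters of probability measures on $X$ are contained in a compact subset $Y\subseteq M$. Then $X$ has a unique circumcenter $y$. Furthermore, $D\geq S(R,\infty,k)$, where $D=\sup_{x_1,x_2\in X}d(x_1,x_2)$ is the diameter of $X$ and $R$ its circumradius. If, in addition, there exists a variance maximizer $\mu\in P(X)$ supported on $n+1$ points (for an integer $n\ge 1$), then $D\geq S(R,n,k)$.
   Context: For $\mu\in P(X)$, $Var(\mu)=\inf_{z\in M}\int_X d^2(x,z)\,d\mu(x)$; a barycenter of $\mu$ is a point attaining the infimum, and a variance maximizer is a maximizer of $Var$ over $P(X)$. The circumradius is $R=\inf_{z\in M}\sup_{x\in X}d(x,z)$ and a circumcenter is a point $y\in M$ with $X\subseteq\bar B(y,R)$. For $k<0$: $S(R,n,k)=\frac{2}{\sqrt{-k}}\sinh^{-1}\big(\sqrt{\tfrac{n+1}{2n}}\sinh(\sqrt{-k}R)\big)$; for $k=0$: $S(R,n,k)=2R\sqrt{\tfrac{n+1}{2n}}$; for $k>0$: $S(R,n,k)=\frac{2}{\sqrt{k}}\sin^{-1}\big(\sqrt{\tfrac{n+1}{2n}}\sin(\sqrt{k}R)\big)$. $S(R,\infty,k)=\lim_{n\to\infty}S(R,n,k)$, i.e. the same formulas with $\sqrt{\tfrac{n+1}{2n}}$ replaced by $\tfrac{1}{\sqrt2}$ (so $S(R,\infty,0)=\sqrt2 R$). *)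

(* Defs.v *)
From HB Require Import structures.
From mathcomp Require Import all_boot all_order all_algebra.
From mathcomp Require Import all_classical all_reals all_analysis.
Set Implicit Arguments. Unset Strict Implicit. Unset Printing Implicit Defensive.
Import Order.TTheory GRing.Theory Num.Theory.
Local Open Scope classical_set_scope.
Local Open Scope ring_scope.

Section Defs.
Variable R : realType.

Definition sinhR (x : R) : R := (expR x - expR (- x)) / 2.
Definition asinhR (x : R) : R := ln (x + Num.sqrt (x ^+ 2 + 1)).
Definition acoshR (x : R) : R := ln (x + Num.sqrt (x ^+ 2 - 1)).

Variable M : Type.
Implicit Types (d : M -> M -> R).

Definition is_metric d :=
  [/\ forall x y, 0 <= d x y,
      forall x y, d x y = 0 <-> x = y,
      forall x y, d x y = d y x &
      forall x y z, d x z <= d x y + d y z].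

Definition mopen d (A : set M) :=
  forall x, A x -> exists2 e : R, 0 < e & forall y, d x y < e -> A y.

Definition mcompact d (X : set M) :=
  forall (I : Type) (U : I -> set M), (forall i, mopen d (U i)) ->
    X `<=` \bigcup_i U i ->
    exists2 F : set I, finite_set F & X `<=` \bigcup_(i in F) U i.

Definition mcomplete d :=
  forall u : nat -> M,
    (forall e : R, 0 < e -> exists N, forall m n, (N <= m)%N -> (N <= n)%N ->
        d (u m) (u n) < e) ->
    exists l, forall e : R, 0 < e -> exists N, forall n, (N <= n)%N -> d (u n) l < e.

Definition geodesic d (g : R -> M) (x y : M) :=
  [/\ g 0 = x, g (d x y) = y &
      forall s t, 0 <= s <= d x y -> 0 <= t <= d x y -> d (g s) (g t) = `|s - t| ].

Definition mpt := (R * R * R)%type.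
Definition px (u : mpt) := u.1.1.
Definition py (u : mpt) := u.1.2.
Definition pz (u : mpt) := u.2.

(* k = 0: Euclidean plane {z = 0};
   k > 0: sphere of radius 1/sqrt k;
   k < 0: upper sheet of the hyperboloid x^2+y^2-z^2 = 1/k (hyperbolic plane). *)
Definition in_model (k : R) (u : mpt) : Prop :=
  if k == 0 then pz u = 0
  else if 0 < k then px u ^+ 2 + py u ^+ 2 + pz u ^+ 2 = k^-1
  else (px u ^+ 2 + py u ^+ 2 - pz u ^+ 2 = k^-1 /\ 0 < pz u).

Definition model_dist (k : R) (u v : mpt) : R :=
  if k == 0 then
    Num.sqrt ((px u - px v) ^+ 2 + (py u - py v) ^+ 2)
  else if 0 < k then
    acos (k * (px u * px v + py u * py v + pz u * pz v)) / Num.sqrt k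
  else
    acoshR (k * (px u * px v + py u * py v - pz u * pz v)) / Num.sqrt (- k).

(* r < D_k, where D_k = pi / sqrt k if k > 0 and D_k = +oo otherwise *)
Definition lt_Dk (k r : R) : Prop := k <= 0 \/ r < pi / Num.sqrt k.

(* CAT(k) inequality for the geodesic triangle with vertices v 0, v 1, v 2
   and sides g i : geodesic from v i to v (i+1 mod 3). *)
Definition CAT_triangle (k : R) d (v : 'I_3 -> M) (g : 'I_3 -> R -> M) :=
  forall V : 'I_3 -> mpt,
    (forall i, in_model k (V i)) ->
    (forall i j, model_dist k (V i) (V j) = d (v i) (v j)) ->
    let cmp i s U :=
      [/\ 0 <= s <= d (v i) (v (ordS i)), in_model k U,
          model_dist k (V i) U = s &
          model_dist k U (V (ordS i)) = d (v i) (v (ordS i)) - s] in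
    forall i j s t U W, cmp i s U -> cmp j t W ->
      d (g i s) (g j t) <= model_dist k U W.

(* CAT(k) space (Bridson--Haefliger II.1.1) *)
Definition CAT d (k : R) :=
  is_metric d /\
  (forall x y, lt_Dk k (d x y) -> exists g, geodesic d g x y) /\
  (forall (v : 'I_3 -> M) (g : 'I_3 -> R -> M),
      (forall i, geodesic d (g i) (v i) (v (ordS i))) ->
      lt_Dk k ((d (v 0) (v 1) + d (v 1) (v 2) + d (v 2) (v 0)) / 2) ->
      CAT_triangle k d v g).

Definition circumradius d (X : set M) : R :=
  inf [set sup [set d x z | x in X] | z in [set: M]].
Definition circumcenter d (X : set M) (y : M) : Prop :=
  forall x, X x -> d x y <= circumradius d X.
Definition diameter d (X : set M) : R :=
  sup [set d x1 x2 | x1 in X & x2 in X].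
End Defs.

Section Measures.
Variable R : realType.
Variables (disp : measure_display) (M : measurableType disp).
Implicit Types (d : M -> M -> R).

Definition probX (X : set M) (mu : probability M R) : Prop := mu X = 1%E.

Definition Var d (mu : probability M R) : \bar R :=
  ereal_inf [set (\int[mu]_x ((d x z) ^+ 2)%:E)%E | z in [set: M]].

Definition barycenter d (mu : probability M R) (z : M) : Prop :=
  (\int[mu]_x ((d x z) ^+ 2)%:E)%E = Var d mu.

Definition var_maximizer d (X : set M) (mu : probability M R) : Prop :=
  probX X mu /\ forall nu, probX X nu -> (Var d nu <= Var d mu)%E.

(* mu is supported on (at most) n+1 points of X *)
Definition supported_on_pts (X : set M) (n : nat) (mu : probability M R) : Prop :=
  exists x : 'I_n.+1 -> M, (forall i, X (x i)) /\ mu (range x) = 1%E.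
End Measures.

Definition S_fun (R : realType) (r : R) (n : nat) (k : R) : R :=
  let c := Num.sqrt ((n.+1)%:R / (2 * n%:R)) in
  if k < 0 then 2 / Num.sqrt (- k) * asinhR (c * sinhR (Num.sqrt (- k) * r))
  else if k == 0 then 2 * r * c
  else 2 / Num.sqrt k * asin (c * sin (Num.sqrt k * r)).

Definition S_inf (R : realType) (r : R) (k : R) : R :=
  let c := Num.sqrt (2^-1) in
  if k < 0 then 2 / Num.sqrt (- k) * asinhR (c * sinhR (Num.sqrt (- k) * r))
  else if k == 0 then 2 * r * c
  else 2 / Num.sqrt k * asin (c * sin (Num.sqrt k * r)).

(* Main.v *)
(** Write [R] for the circumradius and [y] for the circumcenter, which exists
    and is unique because balls of radius less than [pi / (2 sqrt k)] are
    uniformly convex.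

    The minimax theorem, applied to a finite net of [X] and to a convex function
    of the distance, yields finitely supported probabilities on [X] of variance
    at least [R^2 - e].  For [k <= 0] the squared distance itself is convex.  For
    [k > 0] one uses [1 - cos (sqrt k d)] on a small ball around [y], where it is
    convex; comparison along geodesics issued from [y] extends the bound to all
    of [M], and since [arccos ^ 2] is convex a tangent line converts it into
    a bound for [d ^ 2].  Hence a variance maximizer [mu] satisfies
    [R^2 <= \int d(x, z)^2 dmu(x)] for every [z].

    Now move [y] by [t] towards a point [p] of [X] with [d(p, y) = R].  To first
    order, [d(p, _)] decreases by [t] while the other distances grow by at most
    [s t], where [s] depends on [k], [R] and the diameter; so if [p] has mass [l],
    then [l <= (1 - l) s].  Taking [l >= 1 / (n + 1)] gives the bound with [n], and
    taking [l = 0] with the definition of [R] gives the one for infinite [n]. *)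

Require Import Defs.
From HB Require Import structures.
From mathcomp Require Import all_boot all_order all_algebra.
From mathcomp Require Import all_classical all_reals all_analysis.
From mathcomp Require Import measurable_realfun ring lra.
Import Order.TTheory GRing.Theory Num.Theory.
Import numFieldNormedType.Exports.
Local Open Scope classical_set_scope.
Local Open Scope ring_scope.

(** * Trigonometry in constant curvature *)

Section ModelFunctions.
Context {R : realType}.
Implicit Types k t a b : R.

Definition coshR t : R := (expR t + expR (- t)) / 2.

(** [sn k] and [cs k] solve [f'' = - k f] with [(f, f')] equal to [(0, 1)] and [(1, 0)] at [0]: the
    sine and cosine of curvature [k]. *)
Definition sn k t : R :=
  if k < 0 then sinhR (Num.sqrt (- k) * t) / Num.sqrt (- k)
  else if k == 0 then t else sin (Num.sqrt k * t) / Num.sqrt k.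

Definition cs k t : R :=
  if k < 0 then coshR (Num.sqrt (- k) * t)
  else if k == 0 then 1 else cos (Num.sqrt k * t).

(* [md k] is [(1 - cs k) / k], in the form that also covers [k = 0], where it is
   [t ^ 2 / 2]; its use makes the law of cosines uniform in [k]. *)
Definition md k t : R := 2 * sn k (t / 2) ^+ 2.

(** Closed counterpart of [lt_Dk]: [md k] increases up to [D_k] included, a value that truncated
    distances may take. *)
Definition le_Dk k t := k <= 0 \/ t <= pi / Num.sqrt k.

Lemma sn0 k : sn k 0 = 0.
Proof.
rewrite /sn; case: (ltrgt0P k) => _ //; rewrite mulr0 ?sin0 ?mul0r //.
by rewrite /sinhR oppr0 subrr !mul0r.
Qed.

Lemma cs0 k : cs k 0 = 1.
Proof.
rewrite /cs; case: (ltrgt0P k) => _ //; rewrite mulr0 ?cos0 //.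
by rewrite /coshR oppr0 expR0; lra.
Qed.

Lemma snN k t : sn k (- t) = - sn k t.
Proof.
rewrite /sn; case: (ltrgt0P k) => _ //; rewrite mulrN ?sinN ?mulNr //.
by rewrite /sinhR opprK; lra.
Qed.

Lemma csN k t : cs k (- t) = cs k t.
Proof.
rewrite /cs; case: (ltrgt0P k) => _ //; rewrite mulrN ?cosN //.
by rewrite /coshR opprK; lra.
Qed.

Lemma snD k a b : sn k (a + b) = sn k a * cs k b + cs k a * sn k b.
Proof.
rewrite /sn /cs; case: (ltrgt0P k) => k0.
- rewrite mulrDr sinD; ring.
- have s0 : Num.sqrt (- k) != 0 by rewrite gt_eqF ?sqrtr_gt0 ?oppr_gt0.
  by rewrite /sinhR /coshR mulrDr opprD !expRD; field.
- ring.
Qed.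

Lemma csD k a b : cs k (a + b) = cs k a * cs k b - k * (sn k a * sn k b).
Proof.
rewrite /sn /cs; case: (ltrgt0P k) => k0.
- rewrite mulrDr cosD; congr (_ - _).
  have s0 : Num.sqrt k != 0 by rewrite gt_eqF ?sqrtr_gt0.
  rewrite -{3}(sqr_sqrtr (ltW k0)); field => //.
- have Nk0 : 0 < - k by rewrite oppr_gt0.
  have s0 : Num.sqrt (- k) != 0 by rewrite gt_eqF ?sqrtr_gt0.
  have ks : k = - Num.sqrt (- k) ^+ 2 by rewrite sqr_sqrtr ?opprK// ltW.
  rewrite /sinhR /coshR mulrDr opprD !expRD.
  set s := Num.sqrt (- k) in s0 ks *; rewrite ks.
  field => //.
- by rewrite k0; ring.
Qed.

Lemma cs2Dsn2 k t : cs k t ^+ 2 + k * sn k t ^+ 2 = 1.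
Proof. have := csD k t (- t); rewrite subrr cs0 csN snN => ->; ring. Qed.

Lemma sn_half k t : sn k t = 2 * (sn k (t / 2) * cs k (t / 2)).
Proof. by rewrite {1}[t]splitr snD; ring. Qed.

Lemma csE k t : cs k t = 1 - k * md k t.
Proof.
have /(canRL (addrK _)) h := cs2Dsn2 k (t / 2).
by rewrite {1}[t]splitr csD -expr2 h /md; ring.
Qed.

Lemma md0 k : md k 0 = 0.
Proof. by rewrite /md mul0r sn0; ring. Qed.

Lemma mdN k t : md k (- t) = md k t.
Proof. by rewrite /md mulNr snN sqrrN. Qed.

Lemma md_ge0 k t : 0 <= md k t.
Proof. by rewrite mulr_ge0// sqr_ge0. Qed.

Lemma sn2E k t : sn k t ^+ 2 = 2 * md k t - k * md k t ^+ 2.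
Proof.
rewrite sn_half !exprMn /md.
have /(canRL (addrK _)) -> := cs2Dsn2 k (t / 2); ring.
Qed.

Lemma mdD k a b :
  md k (a + b) = md k a + md k b - k * (md k a * md k b) + sn k a * sn k b.
Proof.
rewrite (sn_half k a) (sn_half k b) /md (mulrDl a b) snD.
have /(canRL (addrK _)) ca := cs2Dsn2 k (a / 2).
have /(canRL (addrK _)) cb := cs2Dsn2 k (b / 2).
set x := sn k (a / 2) in ca *; set y := sn k (b / 2) in cb *.
transitivity (2 * (x ^+ 2 * cs k (b / 2) ^+ 2 + cs k (a / 2) ^+ 2 * y ^+ 2)
  + 4 * (x * cs k (b / 2) * cs k (a / 2) * y)); first by ring.
by rewrite ca cb; ring.
Qed.

Lemma mdB k a b :
  md k (a - b) = md k a + md k b - k * (md k a * md k b) - sn k a * sn k b.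
Proof. by rewrite mdD mdN snN; ring. Qed.

Lemma snB k a b : sn k (a - b) = sn k a * cs k b - cs k a * sn k b.
Proof. by rewrite snD csN snN; ring. Qed.

Lemma sinhR_gt0 t : 0 < t -> 0 < sinhR t.
Proof.
by move=> t0; rewrite divr_gt0// subr_gt0 ltr_expR; lra.
Qed.

Lemma sn_gt0 k t : 0 < t -> lt_Dk k t -> 0 < sn k t.
Proof.
move=> t0; rewrite /lt_Dk /sn; case: (ltrgt0P k) => k0 //.
- case=> // tk.
  have s0 : 0 < Num.sqrt k by rewrite sqrtr_gt0.
  rewrite divr_gt0// sin_gt0_pi// mulr_gt0//=.
  by rewrite mulrC -ltr_pdivlMr.
- have s0 : 0 < Num.sqrt (- k) by rewrite sqrtr_gt0 oppr_gt0.
  by move=> _; rewrite divr_gt0// sinhR_gt0// mulr_gt0.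
Qed.

Lemma sn_ge0 k t : 0 <= t -> lt_Dk k t -> 0 <= sn k t.
Proof.
rewrite le_eqVlt => /predU1P[<-|t0 kt]; first by rewrite sn0.
exact/ltW/sn_gt0.
Qed.

Lemma coshR_gt0 t : 0 < coshR t.
Proof. by rewrite divr_gt0// addr_gt0// expR_gt0. Qed.

Lemma cs_gt0 k t : 0 <= t -> lt_Dk k (2 * t) -> 0 < cs k t.
Proof.
move=> t0; rewrite /lt_Dk /cs; case: (ltrgt0P k) => k0 //.
- case=> // tk.
  have s0 : 0 < Num.sqrt k by rewrite sqrtr_gt0.
  have st0 : 0 <= Num.sqrt k * t by rewrite mulr_ge0// ltW.
  apply: cos_gt0_pihalf.
  have p0 := pi_gt0 R.
  move: tk; rewrite ltr_pdivlMr// => tk.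
  apply/andP; split; nra.
- by move=> _; exact: coshR_gt0.
Qed.

Lemma lt_Dk_le k a b : a <= b -> lt_Dk k b -> lt_Dk k a.
Proof. by move=> ab [k0|kb]; [left|right; exact: le_lt_trans kb]. Qed.

Lemma lt_DkW k a : lt_Dk k a -> le_Dk k a.
Proof. by case=> h; [left|right; exact: ltW]. Qed.

Lemma le_Dk_le k a b : a <= b -> le_Dk k b -> le_Dk k a.
Proof. by move=> ab [k0|kb]; [left|right; exact: le_trans kb]. Qed.

Lemma le_Dk_lt k a b : a < b -> le_Dk k b -> lt_Dk k a.
Proof. by move=> ab [k0|kb]; [left|right; exact: lt_le_trans kb]. Qed.

(** Product formula: for [0 <= a < b <= D_k] both factors are positive, whence the monotonicity of
    [md k]. *)
Lemma subr_md k a b :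
  md k b - md k a = 2 * (sn k ((b + a) / 2) * sn k ((b - a) / 2)).
Proof.
set u := (b + a) / 2; set v := (b - a) / 2.
have -> : b = u + v by rewrite /u /v; lra.
have -> : a = u - v by rewrite /u /v; lra.
by rewrite mdD mdB; ring.
Qed.

Lemma lt_md k a b : 0 <= a -> a < b -> le_Dk k b -> md k a < md k b.
Proof.
move=> a0 ab kb; rewrite -subr_gt0 subr_md.
have k1 : lt_Dk k ((b + a) / 2) by apply: le_Dk_lt kb; lra.
have k2 : lt_Dk k ((b - a) / 2) by apply: lt_Dk_le k1; lra.
by rewrite mulr_gt0// mulr_gt0// sn_gt0//; lra.
Qed.

Lemma le_md k a b : 0 <= a -> a <= b -> le_Dk k b -> md k a <= md k b.
Proof.
move=> a0; rewrite le_eqVlt => /predU1P[-> //|ab kb].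
exact/ltW/lt_md.
Qed.

Lemma md_le k a b : 0 <= b -> le_Dk k a -> md k a <= md k b -> a <= b.
Proof.
by move=> b0 ka; apply: contraTT; rewrite -!ltNge => ba; exact: lt_md.
Qed.

(* Great circles of the sphere of curvature [k] have length [2 D_k]. *)
Lemma md_reflect k t : 0 < k -> md k (2 * (pi / Num.sqrt k) - t) = md k t.
Proof.
move=> k0; rewrite -mdN opprB.
have -> : t - 2 * (pi / Num.sqrt k) = t - pi / Num.sqrt k - pi / Num.sqrt k
  by lra.
have s0 : Num.sqrt k != 0 by rewrite gt_eqF ?sqrtr_gt0.
have snpi : sn k (pi / Num.sqrt k) = 0.
  by rewrite /sn ltNge (ltW k0) (gt_eqF k0)/= (mulrC (Num.sqrt k)) divfK// sinpi mul0r.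
have kmd : k * md k (pi / Num.sqrt k) = 2.
  have : cs k (pi / Num.sqrt k) = -1.
    by rewrite /cs ltNge (ltW k0) (gt_eqF k0)/= (mulrC (Num.sqrt k)) divfK// cospi.
  by rewrite csE; lra.
have kn0 : k != 0 by rewrite gt_eqF.
rewrite !mdB snpi.
have -> : md k (pi / Num.sqrt k) = 2 / k.
  by apply: (mulfI kn0); rewrite kmd; field.
by field.
Qed.

(** With [a = t] and [b = d y z] the left side is the correction term of [CAT_geodesic_point]; the
    product displays its sign. *)
Lemma sn_defect k a b :
  sn k a * md k b - sn k b * md k a
  = 4 * (sn k (a / 2) * sn k (b / 2) * sn k ((b - a) / 2)).
Proof.
rewrite (sn_half k a) (sn_half k b) /md mulrBl snB; ring.
Qed.

End ModelFunctions.

(** * Comparison triangles *)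

Section ModelSpace.
Context {R : realType}.
Implicit Types k t a b : R.

(* Polar coordinates about the pole, in the direction of the unit vector [u]. *)
Definition polar k t (u : R * R) : mpt R :=
  (sn k t * u.1, sn k t * u.2, if k == 0 then 0 else cs k t / Num.sqrt `|k|).

Lemma cs_gt0_neg k t : k < 0 -> 0 < cs k t.
Proof. by move=> k0; rewrite /cs k0 coshR_gt0. Qed.

Lemma in_model_polar k t (u : R * R) : u.1 ^+ 2 + u.2 ^+ 2 = 1 ->
  in_model k (polar k t u).
Proof.
move=> u1; rewrite /in_model /polar /px /py /pz/=.
have e : (sn k t * u.1) ^+ 2 + (sn k t * u.2) ^+ 2 = sn k t ^+ 2.
  by rewrite !exprMn -mulrDr u1 mulr1.
have h := cs2Dsn2 k t.
case: (ltrgt0P k) => k0 //.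
- have k1 : k != 0 by rewrite gt_eqF.
  rewrite e exprMn exprVn sqr_sqrtr ?ltW//.
  by apply: (mulfI k1); rewrite mulrDr divff// -h; field.
- have k1 : k != 0 by rewrite lt_eqF.
  rewrite e exprMn exprVn sqr_sqrtr ?oppr_ge0 ?ltW//; split.
    by apply: (mulfI k1); rewrite mulrBr divff// -h; field.
  by rewrite divr_gt0 ?sqrtr_gt0 ?oppr_gt0// cs_gt0_neg.
Qed.

Lemma acoshRK t : 0 <= t -> acoshR (coshR t) = t.
Proof.
move=> t0; rewrite /acoshR.
have -> : coshR t ^+ 2 - 1 = sinhR t ^+ 2.
  rewrite /coshR /sinhR expRN.
  by have := expR_gt0 t; set x := expR t => x0; field; rewrite gt_eqF.
rewrite sqrtr_sqr ger0_norm; last first.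
  by rewrite divr_ge0// subr_ge0 ler_expR; lra.
have -> : coshR t + sinhR t = expR t by rewrite /coshR /sinhR; lra.
exact: expRK.
Qed.

Lemma coshR_acoshR t : 1 <= t -> coshR (acoshR t) = t.
Proof.
move=> t1; rewrite /acoshR.
have t2 : 0 <= t ^+ 2 - 1 by nra.
have : Num.sqrt (t ^+ 2 - 1) ^+ 2 = t ^+ 2 - 1 by rewrite sqr_sqrtr.
have := sqrtr_ge0 (t ^+ 2 - 1); set r := Num.sqrt _ => r0 rE.
have p0 : 0 < t + r by lra.
rewrite /coshR expRN lnK ?posrE//.
have -> : (t + r)^-1 = t - r.
  apply: (mulfI (lt0r_neq0 p0)); rewrite divff ?gt_eqF//.
  by rewrite mulrC -subr_sqr rE; lra.
by lra.
Qed.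

Lemma acoshR_ge0 t : 1 <= t -> 0 <= acoshR t.
Proof.
move=> t1; rewrite ln_ge0//.
by have := sqrtr_ge0 (t ^+ 2 - 1); lra.
Qed.

Lemma k_md_le2 k t : 0 < k -> k * md k t <= 2.
Proof.
move=> k0; suff: -1 <= cs k t by rewrite csE; lra.
by rewrite /cs ltNge (ltW k0) (gt_eqF k0) cos_geN1.
Qed.

(** Inverting [cs k] by [acos] or [acoshR], or taking a square root when [k = 0], turns a value
    given by the law of cosines back into a distance. *)
Lemma md_surj k (e : R) : 0 <= e -> k * e <= 2 ->
  exists2 r, 0 <= r /\ le_Dk k r & md k r = e.
Proof.
move=> e0 ke.
suff [r [r0 kr]] : exists r, [/\ 0 <= r, le_Dk k r &
    (k = 0 -> md 0 r = e) /\ (k != 0 -> cs k r = 1 - k * e)].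
  move=> [h0 h1]; exists r => //.
  have [k0|k0] := eqVneq k 0; first by rewrite k0; exact: h0.
  by have := h1 k0; rewrite csE => ?; apply: (mulfI k0); lra.
case: (ltrgt0P k) => k0.
- have s0 : 0 < Num.sqrt k by rewrite sqrtr_gt0.
  have b1 : -1 <= 1 - k * e <= 1.
    by apply/andP; split; [lra|by rewrite gerBl mulr_ge0 ?(ltW k0)].
  exists (acos (1 - k * e) / Num.sqrt k); split.
  + by rewrite divr_ge0 ?acos_ge0// ltW.
  + by right; rewrite ler_pM2r ?invr_gt0// acos_lepi.
  + split=> [kz|_]; first by rewrite kz ltxx in k0.
    rewrite /cs ltNge (ltW k0) (gt_eqF k0)/= mulrC divfK ?gt_eqF//.
    by rewrite acosK// in_itv.
- have s0 : 0 < Num.sqrt (- k) by rewrite sqrtr_gt0 oppr_gt0.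
  have b1 : 1 <= 1 - k * e by nra.
  exists (acoshR (1 - k * e) / Num.sqrt (- k)); split.
  + by rewrite divr_ge0 ?acoshR_ge0// ltW.
  + by left; exact: ltW.
  + split=> [kz|_]; first by rewrite kz ltxx in k0.
    by rewrite /cs k0 mulrC divfK ?gt_eqF// coshR_acoshR.
- exists (Num.sqrt (2 * e)); split; [exact: sqrtr_ge0|by left; rewrite k0|].
  split=> [_|]; last by rewrite k0.
  rewrite /md /sn ltxx eqxx exprMn sqr_sqrtr; last by lra.
  by field.
Qed.

(** The law of cosines: [u.1 * v.1 + u.2 * v.2] is the cosine of the angle at the pole. For nonzero
    [k], rewriting [md] by [csE] gives the usual form. *)
Lemma model_dist_polar k a b r (u v : R * R) :
  u.1 ^+ 2 + u.2 ^+ 2 = 1 -> v.1 ^+ 2 + v.2 ^+ 2 = 1 ->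
  0 <= r -> le_Dk k r ->
  md k r = md k a + md k b - k * (md k a * md k b)
    - sn k a * sn k b * (u.1 * v.1 + u.2 * v.2) ->
  model_dist k (polar k a u) (polar k b v) = r.
Proof.
move=> u1 v1 r0 kr rE.
have cr : cs k r = cs k a * cs k b
    + k * (sn k a * sn k b * (u.1 * v.1 + u.2 * v.2)).
  by rewrite !csE rE; ring.
rewrite /model_dist /polar /px /py /pz/=.
move: kr rE cr; case: (ltrgt0P k) => k0 kr rE cr.
- have s0 : 0 < Num.sqrt k by rewrite sqrtr_gt0.
  have -> : k * (sn k a * u.1 * (sn k b * v.1) + sn k a * u.2 * (sn k b * v.2) +
     cs k a / Num.sqrt k * (cs k b / Num.sqrt k)) = cs k r.
    rewrite cr mulf_div -expr2 sqr_sqrtr ?ltW//.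
    by field; rewrite gt_eqF.
  rewrite /cs ltNge (ltW k0) (gt_eqF k0)/= cosK.
    by rewrite mulrC mulKf ?gt_eqF.
  rewrite in_itv/= mulr_ge0//= ?(ltW s0)//.
  case: kr => [|kr]; first by rewrite leNgt k0.
  by rewrite mulrC -ler_pdivlMr.
- have s0 : 0 < Num.sqrt (- k) by rewrite sqrtr_gt0 oppr_gt0.
  have -> : k * (sn k a * u.1 * (sn k b * v.1) + sn k a * u.2 * (sn k b * v.2) -
     cs k a / Num.sqrt (- k) * (cs k b / Num.sqrt (- k))) = cs k r.
    rewrite cr mulf_div -expr2 sqr_sqrtr ?oppr_ge0 ?ltW//.
    by field; rewrite lt_eqF.
  rewrite /cs k0 acoshRK ?mulr_ge0 ?(ltW s0)//.
  by rewrite mulrC mulKf ?gt_eqF.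
- move: rE; rewrite k0 /md /sn ltxx eqxx => rE.
  have -> : (a * u.1 - b * v.1) ^+ 2 + (a * u.2 - b * v.2) ^+ 2 = r ^+ 2.
    transitivity (a ^+ 2 * (u.1 ^+ 2 + u.2 ^+ 2)
      + b ^+ 2 * (v.1 ^+ 2 + v.2 ^+ 2)
      - 2 * (a * b * (u.1 * v.1 + u.2 * v.2))); first by ring.
    by rewrite u1 v1; lra.
  by rewrite sqrtr_sqr ger0_norm.
Qed.

(** [u] is the cosine of the comparison angle between the sides [a] and [c]; the triangle
    inequalities place [md k b] between its values at the angles [0] and [pi]. *)
Lemma comparison_angle k a b c : 0 <= a -> 0 < c ->
  `|c - a| <= b -> b <= c + a -> lt_Dk k ((c + b + a) / 2) ->
  exists2 u : R, -1 <= u <= 1 &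
    md k b = md k c + md k a - k * (md k c * md k a) - sn k c * sn k a * u.
Proof.
move=> a0 c0 cab bca kp.
have b0 : 0 <= b by exact: le_trans cab.
have [cab1 cab2] : c - a <= b /\ a - c <= b.
  by move: cab; rewrite ler_norml => /andP[]; lra.
have kb : lt_Dk k b by apply: lt_Dk_le kp; lra.
have kc : lt_Dk k c by apply: lt_Dk_le kp; lra.
have ka : lt_Dk k a by apply: lt_Dk_le kp; lra.
have lb : md k (c - a) <= md k b.
  have -> : md k (c - a) = md k `|c - a|.
    by have [_|_] := ger0P (c - a); rewrite ?mdN.
  by apply: le_md => //; exact: lt_DkW.
have ub : md k b <= md k (c + a).
  have [kca|kca] := pselect (le_Dk k (c + a)); first by rewrite le_md.
  have k0 : 0 < k by rewrite ltNge; apply/negP => k0; apply: kca; left.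
  have {}kca : pi / Num.sqrt k < c + a.
    by rewrite ltNge; apply/negP => h; apply: kca; right.
  case: kp => [|kp]; first by rewrite leNgt k0.
  (* Beyond [D_k] the sum [c + a] is replaced by [2 D_k - (c + a)], which is at least [b] because
     the perimeter is below [2 D_k]. *)
  rewrite -(md_reflect k (c + a) k0) le_md//; first by lra.
  by right; lra.
move: lb ub; rewrite mdB mdD => lb ub.
have [az|an0] := eqVneq a 0.
  exists 1; first by lra.
  by move: lb ub; rewrite az sn0 md0 !mulr0 => *; lra.
have a1 : 0 < a by rewrite lt_def an0.
have s0 : 0 < sn k c * sn k a by rewrite mulr_gt0 ?sn_gt0.
exists ((md k c + md k a - k * (md k c * md k a) - md k b) / (sn k c * sn k a)).
  rewrite ler_pdivlMr// ler_pdivrMr//.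
  by apply/andP; split; lra.
by rewrite [X in _ - X]mulrC divfK ?gt_eqF//; lra.
Qed.

End ModelSpace.

(** * Comparison along a geodesic of a CAT(k) space *)

Section CATGeometry.
Context {R : realType} {M : Type}.
Variables (d : M -> M -> R) (k : R).
Hypothesis Hcat : CAT d k.

Lemma dist_ge0 x y : 0 <= d x y. Proof. by case: Hcat => -[]. Qed.
Lemma distC x y : d x y = d y x. Proof. by case: Hcat => -[]. Qed.
Lemma dist_triangle x y z : d x z <= d x y + d y z.
Proof. by case: Hcat => -[]. Qed.
Lemma distxx x : d x x = 0.
Proof. by case: Hcat => -[_ h _ _] _; apply/h. Qed.
Lemma dist0_eq x y : d x y = 0 -> x = y.
Proof. by case: Hcat => -[_ h _ _] _ /h. Qed.

Lemma norm_distB x y z : `|d x y - d x z| <= d y z.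
Proof.
rewrite ler_norml; have := dist_triangle x y z; have := dist_triangle x z y.
by rewrite (distC z y) => *; apply/andP; split; lra.
Qed.

(** In the model plane this is an equality, Stewart's theorem in curvature [k]; the CAT inequality
    bounds [d m p] by its model value. The comparison triangle has [y] at the pole, [z] in direction
    [(1, 0)] and [p] at the comparison angle. *)
Lemma CAT_geodesic_point y z t : lt_Dk k (d y z) -> 0 < d y z ->
  0 <= t <= d y z ->
  exists m, [/\ d y m = t, d m z = d y z - t &
    forall p, lt_Dk k ((d y z + d z p + d p y) / 2) ->
    sn k (d y z) * md k (d m p)
      + (sn k t * md k (d y z) - sn k (d y z) * md k t)
    <= sn k (d y z - t) * md k (d y p) + sn k t * md k (d z p)].
Proof.
have [_ [Hgeo Htri]] := Hcat.
move=> kyz yz0 /andP[t0 tyz].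
have [g gP] := Hgeo _ _ kyz.
have [g0 g1 gd] := gP.
have tI : 0 <= t <= d y z by rewrite t0 tyz.
exists (g t); split.
- rewrite -{1}g0 gd ?lexx ?dist_ge0//.
  by rewrite sub0r normrN ger0_norm.
- rewrite -{1}g1 gd ?lexx ?dist_ge0//.
  by rewrite distrC ger0_norm// subr_ge0.
move=> p kp.
set a := d y p; set b := d z p; set c := d y z in kyz yz0 tyz gd tI kp *.
have a0 : 0 <= a := dist_ge0 _ _.
have kp' : lt_Dk k ((c + b + a) / 2) by rewrite /a (distC y p).
have bt : b <= c + a.
  by rewrite /b /c (distC y z) dist_triangle.
have ca : `|c - a| <= b by exact: norm_distB.
have cb : c <= a + b by rewrite /a /b (distC z p) dist_triangle.
have ab : a <= c + b by rewrite dist_triangle.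
have ka : lt_Dk k a by apply: lt_Dk_le kp'; lra.
have kb : lt_Dk k b by apply: lt_Dk_le kp'; lra.
have b0 : 0 <= b := dist_ge0 _ _.
have [u uI uE] := comparison_angle k a b c a0 yz0 ca bt kp'.
have [g2 g2P] := Hgeo z p kb.
have [g3 g3P] := Hgeo p y (eq_ind _ (lt_Dk k) ka _ (distC y p)).
pose v (i : 'I_3) := nth y [:: y; z; p] i.
pose G (i : 'I_3) := nth g [:: g; g2; g3] i.
have vG i : geodesic d (G i) (v i) (v (ordS i)).
  by case: i => -[|[|[|//]]] Hi.
have {}Htri := Htri v G vG kp.
pose w := Num.sqrt (1 - u ^+ 2).
have uw : (u, w).1 ^+ 2 + (u, w).2 ^+ 2 = 1.
  by rewrite /= /w sqr_sqrtr; [ring|nra].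
have e1 : (1 : R, 0 : R).1 ^+ 2 + (1 : R, 0 : R).2 ^+ 2 = 1 by rewrite /=; ring.
pose V0 := polar k 0 (1, 0); pose V1 := polar k c (1, 0).
pose V2 := polar k a (u, w).
pose V (i : 'I_3) := nth V0 [:: V0; V1; V2] i.
have VM i : in_model k (V i).
  by case: i => -[|[|[|//]]] Hi; exact: in_model_polar.
have refl s x : x.1 ^+ 2 + x.2 ^+ 2 = 1 ->
    model_dist k (polar k s x) (polar k s x) = 0.
  move=> x1; apply: model_dist_polar => //.
    by right; rewrite divr_ge0 ?pi_ge0// sqrtr_ge0.
  by rewrite -!expr2 x1 mulr1 sn2E md0; ring.
have sym U W : model_dist k U W = model_dist k W U.
  rewrite /model_dist.
  have -> : (px U - px W) ^+ 2 = (px W - px U) ^+ 2 by ring.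
  have -> : (py U - py W) ^+ 2 = (py W - py U) ^+ 2 by ring.
  by rewrite (mulrC (px U)) (mulrC (py U)) (mulrC (pz U)).
have d01 : model_dist k V0 V1 = c.
  apply: model_dist_polar; rewrite ?(ltW yz0)//; first exact: lt_DkW.
  by rewrite md0 sn0; ring.
have d02 : model_dist k V0 V2 = a.
  apply: model_dist_polar => //; first exact: lt_DkW.
  by rewrite md0 sn0; ring.
have d12 : model_dist k V1 V2 = b.
  apply: model_dist_polar => //; first exact: lt_DkW.
  by rewrite uE /=; ring.
have VD i j : model_dist k (V i) (V j) = d (v i) (v j).
  case: i => -[|[|[|//]]] Hi; case: j => -[|[|[|//]]] Hj; rewrite /V /v/=.
  - by rewrite refl// distxx.
  - by [].
  - by [].
  - by rewrite sym distC.
  - by rewrite refl// distxx.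
  - by [].
  - by rewrite sym distC.
  - by rewrite sym distC.
  - by rewrite refl// distxx.
have kc' : le_Dk k c by exact: lt_DkW.
pose U := polar k t (1, 0).
have d0U : model_dist k V0 U = t.
  apply: model_dist_polar => //; first exact: le_Dk_le kc'.
  by rewrite md0 sn0; ring.
have dU1 : model_dist k U V1 = c - t.
  apply: model_dist_polar => //; first by rewrite subr_ge0.
    by apply: le_Dk_le kc'; lra.
  by rewrite mdB /=; ring.
(* By the law of cosines, [E] is [md k] of the distance from [U], the comparison point of [m], to
   [V2]. *)
pose E := md k t + md k a - k * (md k t * md k a) - sn k t * sn k a * u.
have snt : 0 <= sn k t by apply: sn_ge0 => //; apply: lt_Dk_le kyz.
have sna : 0 <= sn k a by exact: sn_ge0.
have E0 : 0 <= E.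
  apply: le_trans (md_ge0 k (t - a)) _; rewrite mdB /E.
  by have := mulr_ge0 snt sna; nra.
have E1 : E <= md k (t + a).
  by rewrite mdD /E; have := mulr_ge0 snt sna; nra.
have kE : k * E <= 2.
  have [k0|k0] := leP k 0; first by have := mulr_ge0 E0 E0; nra.
  by apply: le_trans (k_md_le2 k (t + a) k0); rewrite ler_pM2l.
have [r [r0 kr] rE] := md_surj k E E0 kE.
have dU2 : model_dist k U V2 = r.
  by apply: model_dist_polar => //; rewrite rE /E /=; ring.
have i2 : (2 < 3)%N by [].
have i0 : (0 < 3)%N by [].
(* The vertex [p] is treated as a point of a side: parameter [0] on the side from [p] to [y]. *)
have := Htri V VM VD (Ordinal i0) (Ordinal i2) t 0 U V2.
have G30 : g3 0 = p by case: g3P.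
rewrite /G /= G30 dU2 => key.
have {}key : d (g t) p <= r.
  apply: key; split => //; first exact: in_model_polar.
  - by rewrite /v /= lexx dist_ge0.
  - exact: in_model_polar.
  - exact: refl.
  - by rewrite /V /v /= sym d02 subr0 distC.
have {}key : md k (d (g t) p) <= E.
  by rewrite -rE; apply: le_md => //; exact: dist_ge0.
have snc : 0 < sn k c by exact: sn_gt0.
have {}key : sn k c * md k (d (g t) p) <= sn k c * E by rewrite ler_pM2l.
apply: le_trans (lerD key (lexx _)) _.
rewrite -subr_ge0 le_eqVlt; apply/orP; left; apply/eqP.
rewrite uE /E snB !csE; ring.
Qed.

(* The perimeter hypothesis disappears once distances are truncated at [D_k]. *)
Lemma CAT_geodesic_point_trunc (k0 : 0 < k) y z t : lt_Dk k (d y z) ->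
  0 < d y z -> 0 <= t <= d y z ->
  exists m, d y m = t /\
    forall p, lt_Dk k (d y p + t) ->
    sn k (d y z) * md k (d m p)
      + (sn k t * md k (d y z) - sn k (d y z) * md k t)
    <= sn k (d y z - t) * md k (d y p)
       + sn k t * md k (Num.min (d z p) (pi / Num.sqrt k)).
Proof.
move=> kyz yz0 tI; have [m [mt mz mP]] := CAT_geodesic_point y z t kyz yz0 tI.
exists m; split=> // p kyp.
set c := d y z in kyz yz0 tI mt mz mP *; set D := pi / Num.sqrt k.
have [t0 tc] := andP tI.
have bt : d z p <= c + d y p by rewrite /c (distC y z) dist_triangle.
have a0 := dist_ge0 y p.
have cD : c < D by case: kyz => //; rewrite leNgt k0.
have aD : d y p + t < D by case: kyp => //; rewrite leNgt k0.
have D0 : 0 < D by rewrite divr_gt0 ?pi_gt0// sqrtr_gt0.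
have [per|per] := ltP ((c + d z p + d p y) / 2) D.
  rewrite min_l; first by apply: mP; right.
  by have := dist_triangle z y p; have := dist_triangle z p y;
    rewrite (distC z y) -/c (distC y p) => *; move: per; rewrite (distC p y); lra.
have dmp : d m p <= d y p + t.
  (* The perimeter is now at least [2 D_k]. The bounds [d m p <= d y p + t] and
     [2 D_k - (c + d y p) <= min (d z p) D_k] reduce the claim to an identity, that of a triangle
     lying on a great circle. *)
  by have := dist_triangle m y p; rewrite (distC m y) mt; lra.
rewrite (distC p y) in per.
have h1 : md k (d m p) <= md k (d y p + t).
  by apply: le_md => //; [exact: dist_ge0|exact: lt_DkW].
have h2 : md k (c + d y p) <= md k (Num.min (d z p) D).
  rewrite -(md_reflect k (c + d y p) k0) -/D; apply: le_md.
  - by lra.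
  - by rewrite le_min; apply/andP; split; lra.
  - by right; rewrite ge_min lexx orbT.
have snt : 0 <= sn k t by apply: sn_ge0 => //; apply: lt_Dk_le kyz.
have snc : 0 <= sn k c by apply: sn_ge0 => //; exact: ltW.
have {}h1 := ler_wpM2l snc h1; have {}h2 := ler_wpM2l snt h2.
apply: le_trans (lerD h1 (lexx _)) _.
apply: le_trans (lerD (lexx _) h2).
rewrite -subr_ge0 le_eqVlt; apply/orP; left; apply/eqP.
by rewrite snB !mdD !csE; ring.
Qed.

End CATGeometry.

(** * Derivatives of the model functions *)

Section ModelCalculus.
Context {R : realType}.
Implicit Types k t a b : R.

Lemma is_derive_scale (f : R -> R) (c t b : R) :
  is_derive (c * t) 1 f b -> is_derive t 1 (fun u => f (c * u)) (c * b).
Proof.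
move=> fb; have cc : is_derive t 1 (fun u : R => c *: u) (c *: 1).
  exact: (is_deriveZ (f := id)).
have h : is_derive t 1 (f \o (fun u : R => c *: u)) (b * (c *: 1)).
  exact: is_derive1_comp.
by apply: is_derive_eq h _; rewrite /GRing.scale/= mulr1 mulrC.
Qed.

Lemma is_derive_mull (f : R -> R) (c t b : R) :
  is_derive t 1 f b -> is_derive t 1 (fun u => c * f u) (c * b).
Proof. by move=> fb; exact: (is_deriveZ (f := f)). Qed.

Lemma is_derive_sn k t : is_derive t 1 (sn k) (cs k t).
Proof.
rewrite /sn /cs; case: (ltrgt0P k) => k0.
- have s0 : Num.sqrt k != 0 by rewrite gt_eqF ?sqrtr_gt0.
  rewrite (_ : (fun u => _) = (fun u => (Num.sqrt k)^-1 * sin (Num.sqrt k * u))).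
    apply: is_derive_eq (is_derive_mull _ _ _ _ (is_derive_scale _ _ _ _ _)) _.
    by rewrite mulKf.
  by apply/funext => u; rewrite mulrC.
- have s0 : Num.sqrt (- k) != 0 by rewrite gt_eqF ?sqrtr_gt0 ?oppr_gt0.
  rewrite (_ : (fun u => _) =
    (fun u => (Num.sqrt (- k))^-1 * sinhR (Num.sqrt (- k) * u))).
    apply: is_derive_eq (is_derive_mull _ _ _ _
      (is_derive_scale _ _ _ (coshR (Num.sqrt (- k) * t)) _)) _.
      set x := _ * t.
      rewrite (_ : @sinhR R = (fun u => 2^-1 * (expR - (expR \o -%R)) u)).
        apply: is_derive_eq (is_derive_mull _ _ _ _ _) _.
        by rewrite /coshR; lra.
      by apply/funext => u; rewrite /sinhR mulrC.
    by rewrite mulKf.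
  by apply/funext => u; rewrite mulrC.
- exact: is_derive_id.
Qed.

Lemma is_derive_md k t : is_derive t 1 (md k) (sn k t).
Proof.
have h : is_derive t 1 (fun u => sn k (2^-1 * u)) (2^-1 * cs k (2^-1 * t)).
  exact/is_derive_scale/is_derive_sn.
rewrite (_ : md k = (fun u => 2 * ((fun u => sn k (2^-1 * u)) ^+ 2) u)).
  apply: is_derive_eq (is_derive_mull _ _ _ _ _) _.
  rewrite (sn_half k t) (mulrC 2^-1 t) /GRing.scale/=; lra.
by apply/funext => u; rewrite /md fctE /= (mulrC 2^-1 u).
Qed.

Lemma continuous_md k : continuous (md k).
Proof.
move=> t; apply: differentiable_continuous; apply/derivable1_diffP.
by have := is_derive_md k t => h; exact: ex_derive.
Qed.

Lemma continuous_ball (f : R -> R) t e : {for t, continuous f} -> 0 < e ->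
  exists2 r, 0 < r & forall u, `|t - u| < r -> `|f t - f u| < e.
Proof.
move=> ct e0; have /cvgrPdist_lt/(_ e e0) := ct.
move=> /nbhs_ballP[r /= r0 rP]; exists r => // u tu; exact: rP.
Qed.

Lemma derive_gt0_near0 (f : R -> R) a : f 0 = 0 -> is_derive (0 : R) 1 f a -> 0 < a ->
  exists2 r, 0 < r & forall u, 0 < u < r -> 0 < f u.
Proof.
move=> f0 [fd <-] a0.
have /cvgrPdist_lt/(_ _ a0) := fd.
move=> /nbhs_ballP[r /= r0 rP]; exists r => // u /andP[u0 ur].
have {rP} : `|'D_1 f 0 - u^-1 *: (f (u *: 1 + 0) - f 0)| < 'D_1 f 0.
  apply: rP; last by rewrite gt_eqF.
  by rewrite /ball/= sub0r normrN gtr0_norm.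
rewrite f0 subr0 addr0 /GRing.scale/= mulr1 ltr_distlC => /andP[+ _].
by rewrite subrr pmulr_rgt0 ?invr_gt0.
Qed.

End ModelCalculus.

(** * Circumcenters *)

Section Midpoint.
Context {R : realType} {M : Type}.
Variables (d : M -> M -> R) (k : R).
Hypothesis Hcat : CAT d k.

(** [CAT_geodesic_point] at half the distance, divided by [sn k (d y z / 2)]; for [k = 0] it is the
    Bruhat-Tits inequality. *)
Lemma CAT_midpoint y z : lt_Dk k (d y z) ->
  exists m, [/\ d y m = d y z / 2, d m z = d y z / 2 &
    forall p, lt_Dk k ((d y z + d z p + d p y) / 2) ->
    cs k (d y z / 2) * md k (d m p) + md k (d y z / 2)
    <= (md k (d y p) + md k (d z p)) / 2].
Proof.
move=> kyz; have := dist_ge0 d k Hcat y z.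
rewrite le_eqVlt => /predU1P[/esym yz0|yz0].
  have yz := dist0_eq d k Hcat _ _ yz0; rewrite -yz.
  exists y; rewrite (distxx d k Hcat) mul0r; split => // p _.
  by rewrite cs0 md0; lra.
have t0 : 0 <= d y z / 2 <= d y z by apply/andP; split; lra.
have [m [ym mz mP]] := CAT_geodesic_point d k Hcat y z _ kyz yz0 t0.
exists m; split => //; first by rewrite mz; lra.
move=> p /mP; set c := d y z in kyz yz0 t0 ym mz mP *.
have -> : c - c / 2 = c / 2 by lra.
have kt : lt_Dk k (c / 2) by apply: lt_Dk_le kyz; lra.
have st : 0 < sn k (c / 2) by apply: sn_gt0 => //; lra.
rewrite (sn_half k c).
have -> : md k c = 2 * sn k (c / 2) ^+ 2 by [].
set s := sn k (c / 2) in st *; set e := cs k (c / 2); set q := md k (c / 2).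
have sE : s ^+ 2 - e * q = q by rewrite sn2E /e csE -/q; ring.
move=> h; rewrite -(ler_pM2l st).
have : s * (e * md k (d m p)) + s * (s ^+ 2 - e * q) <=
  s * ((md k (d y p) + md k (d z p)) / 2) by nra.
by rewrite sE; nra.
Qed.

End Midpoint.

(** * Circumradius of a compact set; uniqueness and existence of the circumcenter *)

Section Compactness.
Context {R : realType} {M : Type}.
Variables (d : M -> M -> R) (k : R) (X : set M).
Hypotheses (Hcat : CAT d k) (HXne : X !=set0) (HX : mcompact d X).
Local Notation dC := (distC d k Hcat).
Local Notation dT := (dist_triangle d k Hcat).
Local Notation d_ge0 := (dist_ge0 d k Hcat).

Lemma ball_mopen z r : mopen d [set x | d x z < r].
Proof.
move=> x /= xr; exists (r - d x z); first by rewrite subr_gt0.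
by move=> y xy; have := dT y x z; rewrite (dC y x); lra.
Qed.

Lemma mcompact_increasing (U : nat -> set M) : (forall n, mopen d (U n)) ->
  (forall m n, (m <= n)%N -> U m `<=` U n) -> X `<=` \bigcup_n U n ->
  exists N, X `<=` U N.
Proof.
move=> oU mU /(HX _ _ oU)[F /finite_fsetP[f ->] XF].
exists (\max_(i <- finmap.enum_fset f) i)%N => x /XF[i /= fi Ui].
by apply: mU Ui; exact: leq_bigmax_seq.
Qed.

Lemma dist_has_sup z : has_sup [set d x z | x in X].
Proof.
split; first by have [x Xx] := HXne; exists (d x z); exists x.
have [N XN] : exists N, X `<=` [set x | d x z < N%:R].
  apply: mcompact_increasing => [n|m n mn x /=|x Xx].
  - exact: ball_mopen.
  - by move/lt_le_trans; apply; rewrite ler_nat.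
  - exists (Num.trunc (d x z)).+1 => //=; exact: truncnS_gt.
by exists N%:R => _ [x /XN/= /ltW + <-].
Qed.

Local Notation rad := (circumradius d X).

Lemma rad_has_inf :
  has_inf [set sup [set d x z | x in X] | z in [set: M]].
Proof.
have [x Xx] := HXne.
split; first by exists (sup [set d y x | y in X]); exists x.
exists 0 => _ [z _ <-]; apply: le_trans (d_ge0 x z) _.
by apply: ub_le_sup; [case: (dist_has_sup z)|exists x].
Qed.

Lemma circumradius_le z B : (forall x, X x -> d x z <= B) -> rad <= B.
Proof.
move=> zB; apply: (@le_trans _ _ (sup [set d x z | x in X])).
  by apply: ge_inf; [case: rad_has_inf|exists z].
by apply: ge_sup; [case: (dist_has_sup z)|move=> _ [x Xx <-]; exact: zB].
Qed.

Lemma circumradius_ge0 : 0 <= rad.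
Proof.
have [x Xx] := HXne.
apply: lb_le_inf; first by case: rad_has_inf.
move=> _ [z _ <-]; apply: le_trans (d_ge0 x z) _.
by apply: ub_le_sup; [case: (dist_has_sup z)|exists x].
Qed.

Lemma circumradius_near e : 0 < e ->
  exists z, forall x, X x -> d x z <= rad + e.
Proof.
move=> e0; have [_ [z _ <-] zr] := inf_adherent e0 rad_has_inf.
exists z => x Xx; apply: le_trans (ltW zr).
by apply: ub_le_sup; [case: (dist_has_sup z)|exists x].
Qed.

(** Otherwise the open sets [d x z < rad - 1 / (n + 1)] increase to a cover of [X], and by
    compactness one of them contains [X], contradicting the definition of [rad]. *)
Lemma circumradius_attained z : exists2 x, X x & rad <= d x z.
Proof.
apply: contrapT => h.
have {}h x : X x -> d x z < rad.
  by move=> Xx; rewrite ltNge; apply/negP => zx; apply: h; exists x.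
have [N XN] : exists N, X `<=` [set x | d x z < rad - N.+1%:R^-1].
  apply: (mcompact_increasing (fun n => [set x | d x z < rad - n.+1%:R^-1]))
    => [n|m n mn x /=|x Xx].
  - exact: ball_mopen.
  - move/lt_le_trans; apply; rewrite lerD2l lerN2.
    by rewrite lef_pV2 ?posrE// ler_nat ltnS.
  - have := h x Xx; rewrite -subr_gt0 => xr.
    exists (Num.trunc (rad - d x z)^-1) => //=.
    rewrite ltrBrDr -ltrBrDl -[ltRHS]invrK ltf_pV2 ?posrE ?invr_gt0//.
    exact: truncnS_gt.
have : rad <= rad - N.+1%:R^-1.
  by apply: (circumradius_le z) => x /XN/ltW.
by rewrite leNgt ltrBlDr ltrDl invr_gt0 ltr0n.
Qed.

Lemma circumradius_lt_Dk : (0 < k -> exists c (r : R),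
      r < pi / (2 * Num.sqrt k) /\ X `<=` [set x | d c x < r]) ->
  lt_Dk k (2 * rad).
Proof.
move=> Hball; have [k0|k0] := leP k 0; first by left.
right; have [c [r [rk Xr]]] := Hball k0.
have radr : rad <= r.
  by apply: (circumradius_le c) => x /Xr/= /ltW; rewrite dC.
have : pi / (2 * Num.sqrt k) = pi / Num.sqrt k / 2.
  by field; rewrite gt_eqF// sqrtr_gt0.
lra.
Qed.

Hypothesis Hrad : lt_Dk k (2 * rad).

Lemma cs_rad_gt0 : 0 < cs k rad.
Proof. by apply: cs_gt0 => //; exact: circumradius_ge0. Qed.

(** Uniform convexity: some point of [X] is at distance at least [rad] from the midpoint of [y] and
    [z], and at most [rad + e] from both; the midpoint inequality at that point bounds [d y z]. *)
Lemma near_circumcenters_close e y z : 0 <= e -> lt_Dk k (2 * (rad + e)) ->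
  (forall x, X x -> d x y <= rad + e) -> (forall x, X x -> d x z <= rad + e) ->
  lt_Dk k (d y z) /\
  cs k rad * md k (d y z / 2) <= md k (rad + e) - md k rad.
Proof.
move=> e0 ke Xy Xz.
have r0 := circumradius_ge0.
have [x0 Xx0] := HXne.
have yz2 : d y z <= 2 * (rad + e).
  by have := dT y x0 z; have := Xy _ Xx0; have := Xz _ Xx0; rewrite (dC y x0); lra.
have kyz : lt_Dk k (d y z) by exact: lt_Dk_le ke.
split=> //; have [m [ym mz mP]] := CAT_midpoint d k Hcat y z kyz.
have [x Xx xm] := circumradius_attained m.
have xy := Xy _ Xx; have xz := Xz _ Xx.
have ker : le_Dk k (rad + e) by apply: lt_DkW; apply: lt_Dk_le ke; lra.
have h : md k rad <= md k (d m x).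
  apply: le_md => //; first by rewrite dC.
  apply/lt_DkW/(lt_Dk_le _ _ _ _ ke).
  by have := dT m y x; rewrite (dC m y) ym (dC y x); lra.
have kper : lt_Dk k ((d y z + d z x + d x y) / 2).
  by rewrite (dC z x); apply: lt_Dk_le ke; lra.
have {mP} := mP x kper; rewrite (dC y x) (dC z x) => mP.
have my : md k (d x y) <= md k (rad + e) by apply: le_md => //; exact: d_ge0.
have mz' : md k (d x z) <= md k (rad + e) by apply: le_md => //; exact: d_ge0.
have ct : 0 <= cs k (d y z / 2).
  apply/ltW/cs_gt0; first by rewrite divr_ge0 ?d_ge0.
  by rewrite mulrC divfK.
have := ler_wpM2l ct h; rewrite !csE in mP *; lra.
Qed.

Lemma circumcenter_uniq y z :
  circumcenter d X y -> circumcenter d X z -> y = z.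
Proof.
move=> yP zP; apply: (dist0_eq d k Hcat).
have [||||kyz] := near_circumcenters_close 0 y z; rewrite ?addr0//.
rewrite subrr => h; apply/eqP; rewrite eq_le d_ge0 andbT leNgt.
apply/negP => yz0; move: h; apply/negP; rewrite -ltNge mulr_gt0 ?cs_rad_gt0//.
rewrite -(md0 k); apply: lt_md => //; first by rewrite divr_gt0.
by apply: lt_DkW; apply: lt_Dk_le kyz; lra.
Qed.

Lemma lt_Dk_open a : lt_Dk k a -> exists2 e : R, 0 < e & lt_Dk k (a + e).
Proof.
case=> [k0|ak]; first by exists 1 => //; left.
exists ((pi / Num.sqrt k - a) / 2); first by rewrite divr_gt0// subr_gt0.
by right; lra.
Qed.

(** Centers of balls of radius [rad + 1 / (n + 1)] containing [X] form a Cauchy sequence, by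
    [near_circumcenters_close] and the continuity of [md k] at [rad]. *)
Lemma circumcenter_exists : mcomplete d -> exists y, circumcenter d X y.
Proof.
move=> Hcomp.
have inv0 n : 0 < (n.+1%:R : R)^-1 by rewrite invr_gt0.
pose z n := projT1 (cid (circumradius_near _ (inv0 n))).
have zP n : forall x, X x -> d x (z n) <= rad + n.+1%:R^-1.
  by rewrite /z; case: cid.
have le_inv (e : R) : 0 < e -> exists N, forall n, (N <= n)%N -> n.+1%:R^-1 < e.
  move=> e0; exists (Num.trunc e^-1) => n Nn.
  rewrite -[ltRHS]invrK ltf_pV2 ?posrE ?invr_gt0//.
  by apply: lt_le_trans (truncnS_gt _) _; rewrite ler_nat ltnS.
have [l lP] : exists l, forall e : R, 0 < e ->
    exists N, forall n, (N <= n)%N -> d (z n) l < e.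
  apply: Hcomp => e e0.
  have [e1 e10 ke1] := lt_Dk_open _ Hrad.
  have [e2 e20 ke2] : exists2 e2 : R, 0 < e2 & lt_Dk k e2.
    have [|e2 e20 ke2] := lt_Dk_open 0; last by exists e2 => //; rewrite -[e2]add0r.
    by apply: lt_Dk_le Hrad; rewrite mulr_ge0// circumradius_ge0.
  (* The cap [e2], below [D_k], keeps [e3 / 2] where [md k] is positive. *)
  pose e3 := Num.min e e2.
  have e30 : 0 < e3 by rewrite lt_min e0.
  have m0 : 0 < cs k rad * md k (e3 / 2).
    rewrite mulr_gt0 ?cs_rad_gt0// -(md0 k); apply: lt_md => //.
      by rewrite divr_gt0.
    apply/lt_DkW; apply: lt_Dk_le ke2.
    by apply: (@le_trans _ _ e3); [lra|rewrite ge_min lexx orbT].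
  have [r r0 rP] := continuous_ball (md k) rad _ (continuous_md k rad) m0.
  have [N NP] : exists N, forall n, (N <= n)%N ->
      n.+1%:R^-1 < Num.min (e1 / 2) r.
    by apply: le_inv; rewrite lt_min r0 divr_gt0.
  exists N => m n Nm Nn; have := NP N (leqnn N); rewrite lt_min => /andP[N1 N2].
  set h := N.+1%:R^-1 in N1 N2; have h0 : 0 < h := inv0 N.
  have hz i : (N <= i)%N -> forall x, X x -> d x (z i) <= rad + h.
    move=> Ni x Xx; apply: le_trans (zP i x Xx) _; rewrite lerD2l.
    by rewrite lef_pV2 ?posrE// ler_nat ltnS.
  have [||||kmn dmn] := near_circumcenters_close h (z m) (z n).
  - exact: ltW.
  - by apply: lt_Dk_le ke1; lra.
  - exact: hz.
  - exact: hz.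
  have {}rP : `|md k rad - md k (rad + h)| < cs k rad * md k (e3 / 2).
    by apply: rP; rewrite opprD addrA subrr sub0r normrN gtr0_norm.
  apply: (@lt_le_trans _ _ e3); last by rewrite ge_min lexx.
  rewrite ltNge; apply/negP => e3d.
  have : md k (e3 / 2) <= md k (d (z m) (z n) / 2).
    apply: le_md; [by rewrite divr_ge0// ltW|lra|].
    by apply/lt_DkW/(lt_Dk_le _ _ _ _ kmn); have := d_ge0 (z m) (z n); lra.
  rewrite -(ler_pM2l cs_rad_gt0) => h1.
  by move: rP; rewrite ltr_norml => /andP[]; lra.
exists l => x Xx; apply/ler_addgt0Pr => e e0.
have e20 : 0 < e / 2 by rewrite divr_gt0.
have [N1 N1P] := lP _ e20; have [N2 N2P] := le_inv _ e20.
set n := maxn N1 N2.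
have := N1P n (leq_maxl _ _); have := N2P n (leq_maxr _ _).
have := zP n x Xx; have := dT x (z n) l; set h := n.+1%:R^-1; lra.
Qed.

End Compactness.

(** * The first variation at the circumcenter *)

Section JungFunction.
Context {R : realType}.
Implicit Types k r c t : R.

(** Common form of [S_fun], with [c = sqrt ((n + 1) / (2 n))], and [S_inf], with
    [c = sqrt (1 / 2)]. *)
Definition jung k c r : R :=
  if k < 0 then 2 / Num.sqrt (- k) * asinhR (c * sinhR (Num.sqrt (- k) * r))
  else if k == 0 then 2 * r * c
  else 2 / Num.sqrt k * asin (c * sin (Num.sqrt k * r)).

Lemma asinhR_sinhR t : asinhR (sinhR t) = t.
Proof.
rewrite /asinhR; have -> : sinhR t ^+ 2 + 1 = coshR t ^+ 2.
  rewrite /coshR /sinhR expRN.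
  by have := expR_gt0 t; set x := expR t => x0; field; rewrite gt_eqF.
rewrite sqrtr_sqr ger0_norm ?(ltW (coshR_gt0 t))//.
have -> : sinhR t + coshR t = expR t by rewrite /coshR /sinhR; lra.
exact: expRK.
Qed.

Lemma le_asinhR (a b : R) : 0 <= a -> a <= b -> asinhR a <= asinhR b.
Proof.
move=> a0 ab; rewrite /asinhR.
have sa : 0 < Num.sqrt (a ^+ 2 + 1) by rewrite sqrtr_gt0; nra.
have sab : Num.sqrt (a ^+ 2 + 1) <= Num.sqrt (b ^+ 2 + 1).
  by apply: ler_wsqrtr; rewrite lerD2r ler_sqr ?nnegrE//; lra.
by rewrite ler_ln ?posrE; lra.
Qed.

(** Since [md k D / 2 = sn k (D / 2) ^+ 2], the last hypothesis reads [c * sn k r <= sn k (D / 2)];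
    as [D / 2 <= r] lies where [sn k] is increasing, [sn k] can be inverted. *)
Lemma jung_le k c r D : 0 <= c -> 0 <= r -> lt_Dk k (2 * r) -> 0 <= D ->
  D <= 2 * r -> c ^+ 2 * sn k r ^+ 2 <= md k D / 2 -> jung k c r <= D.
Proof.
move=> c0 r0 kr D0 Dr h.
have kr' : lt_Dk k r by apply: lt_Dk_le kr; lra.
have kD : lt_Dk k (D / 2) by apply: lt_Dk_le kr'; lra.
have {h} : c * sn k r <= sn k (D / 2).
  rewrite -ler_sqr ?nnegrE ?mulr_ge0 ?sn_ge0 ?divr_ge0// exprMn.
  by apply: le_trans h _; rewrite /md; lra.
rewrite /jung /sn; case: (ltrgt0P k) kr => k0 kr.
- have s0 : 0 < Num.sqrt k by rewrite sqrtr_gt0.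
  rewrite mulrA ler_pM2r ?invr_gt0// => h.
  case: kr => [|kr]; first by rewrite leNgt k0.
  rewrite ltr_pdivlMr// in kr.
  set s := Num.sqrt k in s0 h kr *.
  have p0 := pi_gt0 R.
  have u0 : 0 <= c * sin (s * r).
    rewrite mulr_ge0// sin_ge0_pi//; apply/andP; split; last by nra.
    by rewrite mulr_ge0 ?(ltW s0).
  have u1 : c * sin (s * r) <= 1 by apply: le_trans h _; exact: sin_le1.
  have uI : -1 <= c * sin (s * r) <= 1 by apply/andP; split; lra.
  suff : asin (c * sin (s * r)) <= s * (D / 2).
    rewrite -(ler_pM2l s0) => ?; rewrite -(ler_pM2l s0).
    have -> : s * (2 / s * asin (c * sin (s * r))) = 2 * asin (c * sin (s * r)).
      by field; rewrite gt_eqF.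
    nra.
  rewrite leNgt; apply/negP => bad; move: h; apply/negP; rewrite -ltNge.
  rewrite -[ltRHS](@asinK R) ?in_itv// ltr_sin// in_itv/=.
  - have : s * (D / 2) <= s * r by rewrite ler_pM2l//; lra.
    by have := mulr_ge0 (ltW s0) D0; move=> *; apply/andP; split; nra.
  - by rewrite asin_geNpi2// asin_lepi2.
- have s0 : 0 < Num.sqrt (- k) by rewrite sqrtr_gt0 oppr_gt0.
  rewrite mulrA ler_pM2r ?invr_gt0// => h.
  have : asinhR (c * sinhR (Num.sqrt (- k) * r)) <= Num.sqrt (- k) * (D / 2).
    rewrite -[leRHS]asinhR_sinhR le_asinhR// mulr_ge0//.
    by rewrite divr_ge0// subr_ge0 ler_expR; nra.
  set s := Num.sqrt (- k) in s0 h *; set u := asinhR _ => us.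
  rewrite -(ler_pM2l s0).
  have -> : s * (2 / s * u) = 2 * u by field; rewrite gt_eqF.
  nra.
- by move=> h; lra.
Qed.

End JungFunction.

Section FirstVariation.
Context {R : realType} {M : Type}.
Variables (d : M -> M -> R) (k : R) (X : set M).
Hypotheses (Hcat : CAT d k) (HXne : X !=set0) (HX : mcompact d X).
Local Notation dC := (distC d k Hcat).
Local Notation dT := (dist_triangle d k Hcat).
Local Notation d_ge0 := (dist_ge0 d k Hcat).
Local Notation rad := (circumradius d X).
Local Notation D := (diameter d X).

Lemma diameter_bounds :
  [/\ forall x1 x2, X x1 -> X x2 -> d x1 x2 <= D, 0 <= D &
      forall y, circumcenter d X y -> D <= 2 * rad].
Proof.
have [x0 Xx0] := HXne.
have [_ [B BP]] := dist_has_sup d k X Hcat HXne HX x0.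
have ub x1 x2 : X x1 -> X x2 -> d x1 x2 <= D.
  move=> X1 X2; apply: ub_le_sup; last by exists x1 => //; exists x2.
  exists (B + B) => _ [u Xu [v Xv <-]].
  have := dT u x0 v; rewrite (dC x0 v).
  have : d u x0 <= B by apply: BP; exists u.
  have : d v x0 <= B by apply: BP; exists v.
  lra.
split => //; first by rewrite -(distxx d k Hcat x0) ub.
move=> y yP; apply: ge_sup; first by exists (d x0 x0); exists x0 => //; exists x0.
move=> _ [u Xu [v Xv <-]].
by have := dT u y v; have := yP _ Xu; have := yP _ Xv; rewrite (dC y v); lra.
Qed.

Hypothesis Hrad : lt_Dk k (2 * rad).

(* Move [y] a distance [t] towards [p]; to first order in [t] the distance to the
   other points of [X] grows at rate at most [md k D / sn k rad ^+ 2 - 1] while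
   the distance to [p] decreases at rate 1. *)
Lemma first_variation y p (l : R) : 0 < rad -> circumcenter d X y ->
  X p -> d p y = rad -> 0 <= l < 1 ->
  (forall z B, 0 <= B -> (forall x, X x -> d x z <= B) ->
     rad ^+ 2 <= l * d p z ^+ 2 + (1 - l) * B ^+ 2) ->
  sn k rad ^+ 2 <= md k D * (1 - l).
Proof.
move=> r0 yP Xp py /andP[l0 l1] crit; rewrite leNgt; apply/negP => bad.
have [DP D0 /(_ y yP) Dr] := diameter_bounds.
have kr : lt_Dk k rad by apply: lt_Dk_le Hrad; lra.
have sr : 0 < sn k rad by exact: sn_gt0.
set q := sn k rad ^+ 2 in bad.
have q0 : 0 < q by rewrite exprn_gt0.
have l1' : 0 < 1 - l by lra.
(* The mean of the growth rate [(md k D - q) / q] and of [l / (1 - l)]; by [bad] the former is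
   smaller, so [s] lies strictly between them. *)
pose s := ((md k D - q) / q + l / (1 - l)) / 2.
have sq : md k D - q < s * q.
  have -> : s * q = (md k D - q + l * q / (1 - l)) / 2.
    by rewrite /s; field; rewrite !gt_eqF.
  suff : md k D - q < l * q / (1 - l) by lra.
  by rewrite ltr_pdivlMr//; nra.
have sl : (1 - l) * s < l.
  have -> : (1 - l) * s = ((1 - l) * (md k D - q) / q + l) / 2.
    by rewrite /s; field; rewrite !gt_eqF.
  suff : (1 - l) * (md k D - q) / q < l by lra.
  by rewrite ltr_pdivrMr//; nra.
(* [h t] is [sn k rad * md k (rad + s * t)] minus the comparison bound for
   [sn k rad * md k (d x m)], expanded; its derivative at [0] is positive because [s] exceeds the
   growth rate. *)
pose h t := q * sn k (s * t) + (q - md k D) * sn k t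
  + (sn k rad * cs k rad) * md k (s * t) + (- (sn k rad * cs k rad)) * md k t.
have [e e0 eP] : exists2 e, 0 < e & forall t, 0 < t < e -> 0 < h t.
  apply: (derive_gt0_near0 h (q * s + (q - md k D))).
  - by rewrite /h mulr0 sn0 md0; ring.
  - have d1 := is_derive_mull _ q _ _ (is_derive_scale _ s 0 _ (is_derive_sn k _)).
    have d2 := is_derive_mull _ (q - md k D) _ _ (is_derive_sn k 0).
    have d3 := is_derive_mull _ (sn k rad * cs k rad) _ _
      (is_derive_scale _ s 0 _ (is_derive_md k _)).
    have d4 := is_derive_mull _ (- (sn k rad * cs k rad)) _ _ (is_derive_md k 0).
    apply: is_derive_eq (is_deriveD (is_deriveD (is_deriveD d1 d2) d3) d4) _.
    by rewrite mulr0 sn0 cs0; ring.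
  - by lra.
(* In [l * (rad - t) ^+ 2 + (1 - l) * (rad + s * t) ^+ 2] the first-order term is
   [- 2 * rad * w * t], and [w2] is a positive bound for the coefficient of [t ^+ 2]. *)
pose w := l - (1 - l) * s; pose w2 := 1 + l + (1 - l) * s ^+ 2.
have w0 : 0 < w by rewrite /w; lra.
have w20 : 0 < w2.
  by rewrite /w2; have := mulr_ge0 (ltW l1') (sqr_ge0 s); lra.
(* These bounds make [eP] applicable, keep [m] on the geodesic and [rad + s * t] nonnegative even if
   [s < 0], and let the first-order term dominate. *)
have [t [t0 te tr ts tw]] : exists t, [/\ 0 < t, t < e, t <= rad,
    `|s| * t <= rad & w2 * t <= rad * w].
  have s1 : 0 < 1 + `|s| by rewrite ltr_wpDr.
  have a1 : 0 < e / 2 by rewrite divr_gt0.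
  have a2 : 0 < rad / (1 + `|s|) by rewrite divr_gt0.
  have a3 : 0 < rad * w / w2 by rewrite divr_gt0// mulr_gt0.
  have [t t0 [t1 t2 t3 t4]] : exists2 t, 0 < t &
      [/\ t <= e / 2, t <= rad, t <= rad / (1 + `|s|) & t <= rad * w / w2].
    exists (Num.min (Num.min (e / 2) rad)
      (Num.min (rad / (1 + `|s|)) (rad * w / w2))).
      by rewrite !lt_min a1 r0 a2 a3.
    by split; rewrite !ge_min lexx ?orbT.
  exists t; split => //; first by lra.
  - by move: t3; rewrite ler_pdivlMr//; lra.
  - by move: t4; rewrite ler_pdivlMr//; lra.
have s1 : 0 <= rad + s * t by move: ts; have := ler_norm (- s); rewrite normrN; nra.
have yp0 : 0 < d y p by rewrite dC py.
have tI : 0 <= t <= d y p by rewrite dC py (ltW t0).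
have kyp : lt_Dk k (d y p) by rewrite dC py.
have [m [ym mp mP]] := CAT_geodesic_point d k Hcat y p t kyp yp0 tI.
rewrite dC py in kyp yp0 tI mp.
have close x : X x -> d x m <= rad + s * t.
  move=> Xx; apply: (@md_le _ k) => //.
    apply/lt_DkW/(lt_Dk_le _ _ _ _ Hrad).
    by have := dT x y m; have := yP _ Xx; rewrite ym; lra.
  rewrite -(ler_pM2l sr) dC.
  have xy := yP _ Xx; have px := DP _ _ Xp Xx.
  have kper : lt_Dk k ((d y p + d p x + d x y) / 2).
    by apply: lt_Dk_le Hrad; rewrite (dC y p) py; lra.
  have {mP} := mP x kper; rewrite (dC y p) py (dC y x) => mP.
  have my : md k (d x y) <= md k rad.
    by apply: le_md => //; [exact: d_ge0|exact: lt_DkW].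
  have mD : md k (d p x) <= md k D.
    apply: le_md => //; first exact: d_ge0.
    by apply/lt_DkW/(lt_Dk_le _ _ _ _ Hrad).
  have snt : 0 <= sn k t by apply: sn_ge0; [exact: ltW|exact: lt_Dk_le kr].
  have snrt : 0 <= sn k (rad - t).
    by apply: sn_ge0; [lra|apply: lt_Dk_le kr; lra].
  have {}my := ler_wpM2l snrt my; have {}mD := ler_wpM2l snt mD.
  have : 0 < h t by apply: eP; rewrite t0.
  have -> : h t = sn k rad * md k (rad + s * t) - (sn k (rad - t) * md k rad
      + sn k t * md k D - sn k t * md k rad + sn k rad * md k t).
    by rewrite /h {2}/q sn2E /q mdD snB !csE; ring.
  by lra.
have := crit m _ s1 close; rewrite (dC p) mp => {}crit.
have : 0 <= t * (t * (l + (1 - l) * s ^+ 2) - 2 * rad * w).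
  by rewrite /w; nra.
rewrite pmulr_rge0//.
have : t * (l + (1 - l) * s ^+ 2) <= w2 * t by rewrite /w2; nra.
by have := mulr_gt0 r0 w0; lra.
Qed.

End FirstVariation.

(** * Minimax weights *)

Section SineInequalities.
Context {R : realType}.
Implicit Types a b r t : R.

Lemma is_derive_add (f g : R -> R) t (a b : R) :
  is_derive t 1 f a -> is_derive t 1 g b ->
  is_derive t 1 (fun u => f u + g u) (a + b).
Proof. by move=> fa gb; exact: (is_deriveD fa gb). Qed.

Lemma derive_ge0_le (f f' : R -> R) a b :
  (forall t, is_derive t 1 f (f' t)) ->
  (forall t, a <= t <= b -> 0 <= f' t) -> a <= b -> f a <= f b.
Proof.
move=> df f'0 ab.
have [|c cab fab] := @MVT_segment R f f' a b ab.

  apply: continuous_subspaceT => t; apply: differentiable_continuous.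
  by apply/derivable1_diffP; have := df t => h; exact: ex_derive.
by rewrite -subr_ge0 fab mulr_ge0 ?subr_ge0// f'0.
Qed.

Lemma mulr_cos_le_sin t : 0 <= t <= pi -> t * cos t <= sin t.
Proof.
move=> /andP[t0 tpi].
have := @derive_ge0_le (sin - id * cos) (fun u => u * sin u) 0 t.
rewrite !fctE sin0 mul0r subr0 subr_ge0; apply => //.
- by move=> u; apply: is_derive_eq; rewrite /GRing.scale/=; ring.
- move=> u /andP[u0 ut]; rewrite mulr_ge0// sin_ge0_pi// u0/=.
  exact: le_trans tpi.
Qed.

(** [sin t / t] decreases: for [u >= a] the derivative of [u * sin a - a * sin u] is nonnegative, as
    [a * cos u <= a * cos a <= sin a]. *)
Lemma sinc_le a b : 0 <= a -> a <= b -> b <= pi -> a * sin b <= b * sin a.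
Proof.
move=> a0 ab bpi.
have := @derive_ge0_le (fun u => sin a * id u + (- a) * sin u)
  (fun u => sin a * 1 + (- a) * cos u) a b.
move=> h; suff : sin a * a + (- a) * sin a <= sin a * b + (- a) * sin b by lra.
apply: h => //.
move=> u /andP[au ub].
  have h1 : a * cos a <= sin a.
    by apply: mulr_cos_le_sin; rewrite a0 (le_trans ab).
  have h2 : cos u <= cos a.
    by rewrite leNgt ltr_cos ?in_itv/= -?leNgt//; apply/andP; split; lra.
  by have := ler_wpM2l a0 h2; lra.
Qed.

(** The tangent at [cos r] to the convex function [arccos ^ 2], cleared of the denominator [sin r].
    The derivative [2 * (u * sin r - r * sin u)] of the difference changes sign at [u = r] by
    [sinc_le]. *)
Lemma sqr_tangent_cos r t : 0 < r -> r <= pi -> 0 <= t <= pi ->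
  2 * r * (cos r - cos t) <= (t ^+ 2 - r ^+ 2) * sin r.
Proof.
move=> r0 rpi /andP[t0 tpi].
pose f := fun u : R => sin r * (id ^+ 2) u + (2 * r) * cos u.
pose f' := fun u : R => sin r * (2 * u) + (2 * r) * (- sin u).
have df (u : R) : is_derive u 1 f (f' u).
  apply: is_derive_add; apply: is_derive_mull.
  by apply: is_derive_eq; rewrite /GRing.scale/=; ring.
suff : f r <= f t by rewrite /f !fctE; lra.
have [rt|tr] := leP r t.
  apply: (derive_ge0_le _ _ _ _ df) => // u /andP[ru ut].
  by rewrite /f'; have := @sinc_le r u; rewrite ?(ltW r0)//; move=> h;
    have := h isT ru (le_trans ut tpi); lra.
suff : - f t <= - f r by lra.
apply: (@derive_ge0_le (- f) (fun u => - f' u)); last exact: ltW.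
move=> u /andP[tu ur].
by rewrite /f'; have := @sinc_le u r (le_trans t0 tu) ur rpi; lra.
Qed.

Lemma sqr_tangent_md (k r t : R) : 0 < k -> 0 < r -> le_Dk k r ->
  0 <= t -> le_Dk k t ->
  2 * r * (md k t - md k r) <= (t ^+ 2 - r ^+ 2) * sn k r.
Proof.
move=> k0 r0 kr t0 kt.
have s0 : 0 < Num.sqrt k by rewrite sqrtr_gt0.
have scale u : le_Dk k u -> Num.sqrt k * u <= pi.
  by case=> [|uk]; [rewrite leNgt k0|rewrite mulrC -ler_pdivlMr].
have csk u : cos (Num.sqrt k * u) = 1 - k * md k u.
  by rewrite -csE /cs ltNge (ltW k0) (gt_eqF k0).
have snk : sin (Num.sqrt k * r) = Num.sqrt k * sn k r.
  by rewrite /sn ltNge (ltW k0) (gt_eqF k0)/= mulrCA divff ?mulr1 ?gt_eqF.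
have := @sqr_tangent_cos (Num.sqrt k * r) (Num.sqrt k * t).
rewrite !csk snk mulr_gt0// scale// mulr_ge0 ?(ltW s0)//= scale//.
move=> /(_ isT isT isT); rewrite !exprMn sqr_sqrtr ?(ltW k0)//.
have -> : 2 * (Num.sqrt k * r) * (1 - k * md k r - (1 - k * md k t))
   = (Num.sqrt k * k) * (2 * r * (md k t - md k r)) by ring.
have -> : (k * t ^+ 2 - k * r ^+ 2) * (Num.sqrt k * sn k r)
   = (Num.sqrt k * k) * ((t ^+ 2 - r ^+ 2) * sn k r) by ring.
by rewrite ler_pM2l// mulr_gt0.
Qed.

End SineInequalities.

Section Minimax.
Context {R : realType}.

(* Minimize the sum of the squared positive parts of the [f i - c]; the positive
   parts at a near-minimizer, normalized, are the weights. *)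
Lemma finite_minimax (T : Type) (C : set T) (N : nat) (f : 'I_N -> T -> R)
    (B c e : R) : 0 < e -> C !=set0 ->
  (forall i z, C z -> `|f i z| <= B) ->
  (forall z z', C z -> C z' ->
     exists2 m, C m & forall i, f i m <= (f i z + f i z') / 2) ->
  (forall z, C z -> exists i, c + e <= f i z) ->
  exists l : 'I_N -> R, [/\ forall i, 0 <= l i, \sum_i l i = 1 &
    forall z, C z -> c <= \sum_i l i * f i z].
Proof.
move=> e0 [z1 Cz1] fB fmid fc.
pose g i z := f i z - c; pose B' := B + `|c|.
pose u z i := Num.max 0 (g i z).
have u_ge0 z i : 0 <= u z i by rewrite le_max lexx.
have g_leu z i : g i z <= u z i by rewrite le_max lexx orbT.
have gB i z : C z -> `|g i z| <= B'.
  by move=> Cz; apply: le_trans (ler_normB _ _) _; rewrite lerD2r fB.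
have uB i z : C z -> u z i <= B'.
  move=> Cz; rewrite ge_max (le_trans (ler_norm _) (gB _ _ Cz)) andbT.
  exact: le_trans (normr_ge0 _) (gB i _ Cz).
(* Repeated midpoints with [z] bring the weight of [z'] down to [2 ^ -j], as small as a first-order
   argument requires. *)
have dyadic j z z' : C z -> C z' -> exists2 m, C m &
    forall i, g i m <= (1 - 2^-1 ^+ j) * g i z + 2^-1 ^+ j * g i z'.
  move=> Cz Cz'; elim: j => [|j [m Cm mP]].
    by exists z' => // i; rewrite expr0; lra.
  have [m' Cm' m'P] := fmid z m Cz Cm; exists m' => // i.
  have := mP i; have := m'P i; rewrite /g exprS; lra.
pose Phi z := \sum_i u z i ^+ 2.
have Phi_ge z : C z -> e ^+ 2 <= Phi z.
  move=> Cz; have [i fi] := fc z Cz.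
  rewrite /Phi (bigD1 i)//= -[leLHS]addr0 lerD//.
    rewrite ler_sqr ?nnegrE// ?(ltW e0)//; apply: le_trans (g_leu z i).
    by rewrite /g; lra.
  by apply: sumr_ge0 => j _; exact: sqr_ge0.
have Pinf : has_inf [set Phi z | z in C].
  split; first by exists (Phi z1); exists z1.
  by exists (e ^+ 2) => _ [z Cz <-]; exact: Phi_ge.
(* [Q] bounds the coefficient of [t ^+ 2] when [Phi] is expanded along a step of size [t = 2 ^ -j];
   [j] is such that [t * Q <= e ^+ 2]. *)
pose Q := \sum_(i < N) (2 * B') ^+ 2 + 1.
have Q0 : 0 < Q.
  by rewrite ltr_wpDl// sumr_ge0// => i _; exact: sqr_ge0.
have e20 : 0 < e ^+ 2 by rewrite exprn_gt0.
have [j jQ] : exists j, (2^-1 : R) ^+ j * Q <= e ^+ 2.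
  exists (Num.trunc (Q / e ^+ 2)).+1.
  rewrite exprVn mulrC ler_pdivrMr ?exprn_gt0//.
  rewrite mulrC -ler_pdivrMr//; apply: (le_trans (ltW (truncnS_gt _))).
  by rewrite -natrX ler_nat ltnW// ltn_expl.
set t := 2^-1 ^+ j in jQ.
have t0 : 0 < t by rewrite exprn_gt0// invr_gt0.
have [_ [z0 Cz0 <-] z0P] := inf_adherent (mulr_gt0 t0 e20) Pinf.
set S := Phi z0 in z0P.
have key z : C z -> 0 <= \sum_i u z0 i * g i z.
  move=> Cz; have [m Cm mP] := dyadic j z0 z Cz0 Cz; rewrite -/t in mP.
  have t1 : t <= 1 by apply: exprn_ile1; rewrite ?invr_ge0// invf_le1// ler1n.
  have h1 : inf [set Phi z | z in C] <= Phi m.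
    by apply: ge_inf; [case: Pinf|exists m].
  set P := \sum_i u z0 i * g i z.
  have h2 : Phi m <= S + 2 * t * (P - S) + t ^+ 2 * Q.
    apply: (@le_trans _ _ (\sum_i ((1 - t) * u z0 i + t * g i z) ^+ 2)).
      apply: ler_sum => i _.
      have gm : g i m <= (1 - t) * u z0 i + t * g i z.
        by apply: le_trans (mP i) _; rewrite lerD2r ler_wpM2l// subr_ge0.
      rewrite {1}/u; have [_|gm0] := leP (g i m) 0.
        by rewrite expr0n sqr_ge0.
      by rewrite ler_sqr ?nnegrE//; [exact: ltW|apply: le_trans gm; exact: ltW].
    rewrite /P /S /Phi -sumrB !mulr_sumr mulrDr mulr1 mulr_sumr.
    rewrite addrA -!big_split/= -[leLHS]addr0 lerD// ?sqr_ge0//.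
    apply: ler_sum => i _.
    have : (g i z - u z0 i) ^+ 2 <= (2 * B') ^+ 2.
      rewrite -[leLHS]real_normK ?num_real//.
      have : `|g i z - u z0 i| <= 2 * B'.
        apply: le_trans (ler_normB _ _) _.
        by have := gB i z Cz; have := uB i z0 Cz0; rewrite (ger0_norm (u_ge0 _ _)); lra.
      by move=> h; rewrite ler_sqr ?nnegrE//; apply: le_trans h.
    move=> h; have := ler_wpM2l (sqr_ge0 t) h; nra.
  (* Near-minimality and the second-order term each cost at most [t * e ^+ 2]; the term
     [- 2 * t * S] pays for both. *)
  have S0 : e ^+ 2 <= S by exact: Phi_ge.
  have : 0 <= t * (e ^+ 2 + 2 * (P - S) + t * Q) by nra.
  by rewrite pmulr_rge0//; lra.
have U0 : 0 < \sum_i u z0 i.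
  have [i fi] := fc z0 Cz0; rewrite (bigD1 i)//= ltr_pwDl//.
    by apply: lt_le_trans (g_leu z0 i); rewrite /g; lra.
  by apply: sumr_ge0.
exists (fun i => u z0 i / \sum_i u z0 i); split.
- by move=> i; rewrite divr_ge0// ltW.
- by rewrite -mulr_suml divff// gt_eqF.
- move=> z /key; set U := \sum_i u z0 i => kz.
  have -> : \sum_i u z0 i / U * f i z = U^-1 * (\sum_i u z0 i * g i z) + c.
    transitivity (\sum_i (U^-1 * (u z0 i * g i z) + (u z0 i / U) * c)).
      by apply: eq_bigr => i _; rewrite /g; ring.
    rewrite big_split/= -mulr_sumr -mulr_suml -mulr_suml -/U divff ?mul1r//.
    by rewrite gt_eqF.
  by rewrite lerDr mulr_ge0// invr_ge0 ltW.
Qed.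

End Minimax.

(** * Finitely supported weights of variance almost [rad ^+ 2] *)

Section Weights.
Context {R : realType} {M : Type}.
Variables (d : M -> M -> R) (k : R) (X : set M).
Hypotheses (Hcat : CAT d k) (HXne : X !=set0) (HX : mcompact d X).
Local Notation dC := (distC d k Hcat).
Local Notation dT := (dist_triangle d k Hcat).
Local Notation d_ge0 := (dist_ge0 d k Hcat).
Local Notation rad := (circumradius d X).

Lemma finite_net e : 0 < e -> exists N (x : 'I_N -> M),
  (forall i, X (x i)) /\ forall p, X p -> exists i, d p (x i) < e.
Proof.
move=> e0.
(* Centers outside [X] are given the empty set, so that discarding them keeps a cover; [{classic M}]
   supplies the decidable equality for lists. *)
have [||F /finite_fsetP[f ->] XF] :=
  HX {classic M} (fun x => [set p | X x /\ d p x < e]).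
- move=> x; have [Xx|Xx] := pselect (X x); last by move=> p [].
  have := ball_mopen d k Hcat x e => h p [_ /h[r r0 rP]].
  by exists r => // q /rP.
- by move=> p Xp; exists p => //=; split=> //; rewrite (distxx d k Hcat).
have [x0 Xx0] := HXne.
pose s := [seq x <- finmap.enum_fset f | `[< X x >]] : seq {classic M}.
exists (size s), (fun i => nth (x0 : {classic M}) s i); split.
- move=> i; have : nth (x0 : {classic M}) s i \in s by exact: mem_nth.
  by rewrite mem_filter => /andP[/asboolP].
- move=> p /XF[x /= fx [Xx px]].
  have xs : x \in s by rewrite mem_filter fx andbT; apply/asboolP.
  have xs' : (index x s < size s)%N by rewrite index_mem.
  by exists (Ordinal xs'); rewrite /= nth_index.
Qed.

(** Every [z] is at distance at least [rad] from some point of [X], hence at least [rad - h] from a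
    point of an [h]-net; continuity of [phi] at [rad] makes the loss less than [e / 2], and
    [finite_minimax] applies to the net. *)
Lemma minimax_weights (C : set M) (phi : R -> R) L e :
  0 < rad -> 0 < e -> C !=set0 ->
  (forall z x, C z -> X x -> d x z <= L) ->
  (forall t, 0 <= phi t) ->
  (forall a b, 0 <= a -> a <= b -> b <= L -> phi a <= phi b) ->
  {for rad, continuous phi} ->
  (forall z z', C z -> C z' -> exists2 m, C m &
     forall x, X x -> phi (d x m) <= (phi (d x z) + phi (d x z')) / 2) ->
  exists N (x : 'I_N -> M) (l : 'I_N -> R),
    [/\ forall i, X (x i), forall i, 0 <= l i, \sum_i l i = 1 &
      forall z, C z -> phi rad - e <= \sum_i l i * phi (d (x i) z)].
Proof.
move=> r0 e0 C0 CL phi0 phile phic phimid.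
have e20 : 0 < e / 2 by rewrite divr_gt0.
have [r rp rP] := continuous_ball phi rad _ phic e20.
pose h := Num.min r rad / 2.
have h0 : 0 < h by rewrite divr_gt0// lt_min rp.
have [hr hrad] : h < r /\ h <= rad.
  have : Num.min r rad <= r by rewrite ge_min lexx.
  have : Num.min r rad <= rad by rewrite ge_min lexx orbT.
  by move: h0; rewrite /h; split; lra.
have [N [x [xX xnet]]] := finite_net h h0.
have [|||l [l0 l1 lP]] := finite_minimax M C N (fun i z => phi (d (x i) z))
  (phi L) (phi rad - e) (e / 2) e20 C0.
- by move=> i z Cz; rewrite ger0_norm// phile ?d_ge0// CL.
- move=> z z' Cz Cz'; have [m Cm mP] := phimid z z' Cz Cz'.
  by exists m => // i; exact: mP.
- move=> z Cz; have [p Xp pz] := circumradius_attained d k X Hcat HXne HX z.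
  have [i pi] := xnet p Xp; exists i.
  have : phi (rad - h) <= phi (d (x i) z).
    apply: phile; [by rewrite subr_ge0| |exact: CL].
    by have := dT p (x i) z; lra.
  have : `|phi rad - phi (rad - h)| < e / 2.
    by apply: rP; rewrite opprB addrC subrK gtr0_norm.
  by rewrite ltr_norml => /andP[]; lra.
by exists N, x, l; split.
Qed.

(** The mean of [md k a] and [md k b] is [md k] of the mean plus a term in [(a - b) / 2], controlled
    by [d y z / 2]; the midpoint inequality absorbs this term. *)
Lemma dist_midpoint_convex y z : k <= 0 ->
  exists m, forall p, d m p <= (d y p + d z p) / 2.
Proof.
move=> k0; have [m [_ _ mP]] := CAT_midpoint d k Hcat y z (or_introl k0).
exists m => p; have := mP p (or_introl k0).
set a := d y p; set b := d z p; set t := d y z / 2.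
have ab : md k ((a - b) / 2) <= md k t.
  have -> : md k ((a - b) / 2) = md k `|(a - b) / 2|.
    by have [_|_] := ger0P ((a - b) / 2); rewrite ?mdN.
  apply: le_md => //; last by left.
  rewrite normrM (@ger0_norm _ (2^-1 : R)) ?invr_ge0// ler_pM2r ?invr_gt0//.
  by rewrite /a /b (dC y p) (dC z p); exact: (norm_distB d k Hcat).
have -> : (md k a + md k b) / 2 = md k ((a + b) / 2)
    + md k ((a - b) / 2) * cs k ((a + b) / 2).
  set p1 := (a + b) / 2; set p2 := (a - b) / 2.
  have -> : a = p1 + p2 by rewrite /p1 /p2; lra.
  have -> : b = p1 - p2 by rewrite /p1 /p2; lra.
  by rewrite mdD mdB csE; field.
move=> h.
have c1 : 1 <= cs k ((a + b) / 2).
  by rewrite csE; have := md_ge0 k ((a + b) / 2); nra.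
have ct : 0 < cs k t.
  by rewrite csE; have := md_ge0 k t; nra.
apply: (@md_le _ k).
- by rewrite divr_ge0// addr_ge0 ?d_ge0.
- by left.
rewrite -(ler_pM2l ct).
have := ler_wpM2r (le_trans ler01 c1) ab.
have -> : cs k t * md k ((a + b) / 2) = md k ((a + b) / 2)
   + md k t * cs k ((a + b) / 2) - md k t by rewrite !csE; ring.
by move: h; lra.
Qed.

Hypothesis Hrad : lt_Dk k (2 * rad).

(** Minimax is run on the ball of radius [2 * rad] about [y], stable under midpoints; outside it all
    points of [X] are at distance at least [rad]. *)
Lemma variance_weights_npos y e : k <= 0 -> 0 < rad -> circumcenter d X y ->
  0 < e -> exists N (x : 'I_N -> M) (l : 'I_N -> R),
    [/\ forall i, X (x i), forall i, 0 <= l i, \sum_i l i = 1 &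
      forall z, rad ^+ 2 - e <= \sum_i l i * d (x i) z ^+ 2].
Proof.
move=> k0 r0 yP e0.
have [||||||N [x [l [xX l0 l1 lP]]]] := minimax_weights
  [set z | d y z <= 2 * rad] (fun t => t ^+ 2) (3 * rad) e r0 e0.
- by exists y; rewrite /= (distxx d k Hcat); lra.
- by move=> z x /= yz Xx; have := dT x y z; have := yP x Xx; lra.
- by move=> t; exact: sqr_ge0.
- by move=> a b a0 ab _; rewrite ler_sqr ?nnegrE// (le_trans a0).
- exact: exprn_continuous.
- move=> z z' /= yz yz'; have [m mP] := dist_midpoint_convex z z' k0.
  exists m; first by rewrite /= dC; have := mP y; rewrite (dC z y) (dC z' y); lra.
  move=> x _; have := mP x; rewrite !(dC x) => h.
  have : d m x ^+ 2 <= ((d z x + d z' x) / 2) ^+ 2.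
    by rewrite ler_sqr ?nnegrE ?divr_ge0 ?addr_ge0 ?d_ge0.
  by have := sqr_ge0 (d z x - d z' x); nra.
exists N, x, l; split => // z.
have [yz|yz] := leP (d y z) (2 * rad); first exact: lP.
apply: (@le_trans _ _ (\sum_i l i * rad ^+ 2)).
  by rewrite -mulr_suml l1; lra.
apply: ler_sum => i _; rewrite ler_wpM2l// ler_sqr ?nnegrE ?d_ge0 ?(ltW r0)//.
by have := dT y (x i) z; have := yP _ (xX i); rewrite (dC y (x i)); lra.
Qed.

(** Minimax for [md k] on a ball of radius [t] about [y], then comparison along the geodesic from
    [y] to [z], then the tangent line bound to pass to squared distances. *)
Lemma variance_weights_pos y e : 0 < k -> 0 < rad -> circumcenter d X y ->
  0 < e -> exists N (x : 'I_N -> M) (l : 'I_N -> R),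
    [/\ forall i, X (x i), forall i, 0 <= l i, \sum_i l i = 1 &
      forall z, rad ^+ 2 - e <= \sum_i l i * d (x i) z ^+ 2].
Proof.
move=> k0 r0 yP e0.
set D := pi / Num.sqrt k.
have s0 : 0 < Num.sqrt k by rewrite sqrtr_gt0.
have [e1 e10 ke1] := lt_Dk_open k _ Hrad.
(* Thus [2 * (rad + 2 * t)] is still below [D_k]. *)
pose t := e1 / 4.
have t0 : 0 < t by rewrite divr_gt0.
have kt a : a <= rad + 2 * t -> lt_Dk k (2 * a).
  by move=> at_; apply: lt_Dk_le ke1; rewrite /t in at_; lra.
have kt' a : a <= rad + 2 * t -> lt_Dk k a.
  by move=> at_; apply: lt_Dk_le (kt _ (lexx _)); lra.
have sr : 0 < sn k rad by apply: sn_gt0 => //; apply: kt'; lra.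
have st : 0 < sn k t by apply: sn_gt0 => //; apply: kt'; lra.
(* [K] bounds the factor [sn k (d y z) / sn k t] by which the error grows on the way to [z]; [e2]
   then satisfies [2 * rad * (e2 * K) = e * sn k rad]. *)
pose K := 1 + (Num.sqrt k * sn k t)^-1.
have stK : 0 < (Num.sqrt k * sn k t)^-1 by rewrite invr_gt0 mulr_gt0.
have K0 : 0 < K by rewrite /K; lra.
pose e2 := e * sn k rad / (2 * rad * K).
have e20 : 0 < e2 by rewrite divr_gt0 ?mulr_gt0.
pose C := [set z | d y z <= t].
have mid z z' : C z -> C z' -> exists m, d y m <= 2 * t /\ forall p, d y p <= rad ->
    md k (d p m) <= (md k (d p z) + md k (d p z')) / 2.
  rewrite /C/= => yz yz'.
  have zz' : d z z' <= 2 * t by have := dT z y z'; rewrite (dC z y); lra.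
  have kzz : lt_Dk k (d z z') by apply: kt'; lra.
  have [m [zm mz mP]] := CAT_midpoint d k Hcat z z' kzz.
  exists m; split=> [|p yp]; first by have := dT y z m; rewrite zm; lra.
  have zp : d z p <= rad + t by have := dT z y p; rewrite (dC z y); lra.
  have zp' : d z' p <= rad + t by have := dT z' y p; rewrite (dC z' y); lra.
  have kper : lt_Dk k ((d z z' + d z' p + d p z) / 2).
    by apply: kt'; rewrite (dC p); lra.
  have := mP p kper; rewrite !(dC p).
  (* The correction terms combine into [md k (d z z' / 2) * cs k (d m p)], so this sign gives
     convexity. *)
  have : 0 <= cs k (d m p).
    apply/ltW/cs_gt0; first exact: d_ge0.
    by apply: kt; have := dT m z p; rewrite (dC m z) zm; lra.
  rewrite !csE => cm h; have := mulr_ge0 (md_ge0 k (d z z' / 2)) cm; nra.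
have [||||||N [x [l [xX l0 l1 lP]]]] := minimax_weights C (md k) (rad + t) e2 r0 e20.
- by exists y; rewrite /C/= (distxx d k Hcat) ltW.
- by move=> z x /= yz Xx; have := dT x y z; have := yP x Xx; rewrite /C/= in yz; lra.
- by move=> u; exact: md_ge0.
- move=> a b a0 ab bt; apply: le_md => //; apply/lt_DkW/kt'; lra.
- exact: continuous_md.
- move=> z z' Cz Cz'; have [m [ym mP]] := mid z z' Cz Cz'.
  have tD : le_Dk k t by apply/lt_DkW/kt'; lra.
  exists m; last by move=> x Xx; apply: mP; rewrite dC yP.
  (* Convexity at [p = y] shows that the midpoint stays in [C]. *)
  have := mP y; rewrite (distxx d k Hcat) (ltW r0) => /(_ isT) h.
  apply: (@md_le _ k); first exact: ltW.
    by apply/lt_DkW/kt'; lra.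
  have h1 : md k (d y z) <= md k t by apply: le_md => //; exact: d_ge0.
  have h2 : md k (d y z') <= md k t by apply: le_md => //; exact: d_ge0.
  by lra.
exists N, x, l; split => // z.
have D0 : 0 < D by rewrite divr_gt0// pi_gt0.
(* Truncation keeps the arguments of [md k] in its monotone range and only lowers the sum to be
   bounded. *)
pose th i := Num.min (d (x i) z) D.
have th0 i : 0 <= th i by rewrite le_min d_ge0 ltW.
have thD i : le_Dk k (th i) by right; rewrite ge_min lexx orbT.
have thd i : th i <= d (x i) z by rewrite ge_min lexx.
have [yz|yz] := leP (2 * rad) (d y z).
  apply: (@le_trans _ _ (\sum_i l i * rad ^+ 2)).
    by rewrite -mulr_suml l1; lra.
  apply: ler_sum => i _; rewrite ler_wpM2l// ler_sqr ?nnegrE ?d_ge0 ?(ltW r0)//.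
  by have := dT y (x i) z; have := yP _ (xX i); rewrite (dC y (x i)); lra.
suff I : md k rad - e2 * K <= \sum_i l i * md k (th i).
  apply: (@le_trans _ _ (\sum_i l i * th i ^+ 2)); last first.
    by apply: ler_sum => i _; rewrite ler_wpM2l// ler_sqr ?nnegrE ?d_ge0.
  have : \sum_i l i * (rad ^+ 2 * sn k rad + 2 * rad * (md k (th i) - md k rad))
      <= \sum_i l i * (th i ^+ 2 * sn k rad).
    apply: ler_sum => i _; rewrite ler_wpM2l//.
    have kr : le_Dk k rad by apply/lt_DkW/kt'; lra.
    by have := sqr_tangent_md k rad (th i) k0 r0 kr (th0 i) (thD i); lra.
  have -> : \sum_i l i * (th i ^+ 2 * sn k rad) = (\sum_i l i * th i ^+ 2) * sn k rad.
    by rewrite mulr_suml; apply: eq_bigr => i _; ring.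
  have -> : \sum_i l i * (rad ^+ 2 * sn k rad + 2 * rad * (md k (th i) - md k rad))
     = (rad ^+ 2 * sn k rad - 2 * rad * md k rad)
       + 2 * rad * (\sum_i l i * md k (th i)).
    rewrite -[X in X + _]mul1r -l1 mulr_suml mulr_sumr -big_split/=.
    by apply: eq_bigr => i _; ring.
  move=> h; rewrite -(ler_pM2r sr); apply: le_trans h.
  have eK : 2 * rad * (e2 * K) = e * sn k rad.
    by rewrite /e2; field; rewrite !gt_eqF.
  by have := ler_wpM2l (ltW (mulr_gt0 (ltr0n R 2) r0)) I; lra.
have [yzt|tyz] := leP (d y z) t.
  have := lP z yzt.
  have -> : \sum_i l i * md k (d (x i) z) = \sum_i l i * md k (th i).
    apply: eq_bigr => i _; congr (_ * md _ _); rewrite /th min_l//.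
    have : d (x i) z <= rad + t.
      by have := dT (x i) y z; have := yP _ (xX i); lra.
    move=> xz; have : lt_Dk k (d (x i) z) by apply: kt'; lra.
    by case=> [|/ltW//]; rewrite leNgt k0.
  by apply: le_trans; rewrite lerD2l lerN2 ler_peMr ?(ltW e20)// /K; lra.
have kyz : lt_Dk k (d y z) by apply: lt_Dk_le Hrad; exact: ltW.
have yz0 : 0 < d y z by lra.
have tI : 0 <= t <= d y z by rewrite !ltW.
(* The minimax bound holds at [m], at distance [t] from [y]; comparison at each [x i] carries it to
   [z]. *)
have [m [ym mP]] := CAT_geodesic_point_trunc d k Hcat k0 y z t kyz yz0 tI.
have Cm : C m by rewrite /C/= ym.
have := lP m Cm; set P := \sum_i _ => mlow.
set I := \sum_i _.
have snyz : 0 < sn k (d y z) by exact: sn_gt0.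
have snr : 0 <= sn k (d y z - t).
  by apply: sn_ge0; [lra|apply: lt_Dk_le kyz; lra].
set c := d y z in tyz kyz yz0 tI mP snyz snr yz *.
set Df := sn k t * md k c - sn k c * md k t.
have Df0 : 0 <= Df.
  have half u : 0 <= u -> u <= c -> 0 <= sn k (u / 2).
    move=> u0 uc; apply: sn_ge0; first by rewrite divr_ge0.
    by apply: lt_Dk_le kyz; lra.
  by rewrite /Df sn_defect !mulr_ge0// half//; lra.
have hsum : sn k c * P + Df <= sn k (c - t) * md k rad + sn k t * I.
  rewrite /P /I !mulr_sumr -[Df]mul1r -[X in _ <= X + _]mul1r -l1 !mulr_suml.
  rewrite -!big_split/=; apply: ler_sum => i _.
  have kxi : lt_Dk k (d y (x i) + t).
    by apply: kt'; have := yP _ (xX i); rewrite (dC y (x i)); lra.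
  have := mP (x i) kxi; rewrite (dC m) (dC z).
  have : md k (d y (x i)) <= md k rad.
    apply: le_md; rewrite ?d_ge0//; first by rewrite dC yP.
    by apply/lt_DkW/kt'; lra.
  move=> /(ler_wpM2l snr) h1 h2.
  have {h1}h2 := le_trans h2 (lerD h1 (lexx _)).
  by have := ler_wpM2l (l0 i) h2; rewrite -/D -/(th i) /Df; lra.
have crad : 0 < cs k rad by apply: cs_gt0; [exact: ltW|exact: Hrad].
(* By this identity, and since [Df * cs k rad] is nonnegative, the only loss is [e2 * sn k c]. *)
have sub : sn k c * md k rad - sn k (c - t) * md k rad + Df
    = sn k t * md k rad + Df * cs k rad.
  by rewrite /Df snB !csE; ring.
have h1 : sn k t * md k rad - e2 * sn k c <= sn k t * I.
  have := ler_wpM2l (ltW snyz) mlow; have := mulr_ge0 Df0 (ltW crad); lra.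
have snle : sn k c <= (Num.sqrt k)^-1.
  by rewrite /sn ltNge (ltW k0) (gt_eqF k0)/= ler_piMl ?invr_ge0 ?(ltW s0)//.
rewrite -(ler_pM2l st); apply: le_trans h1.
have : e2 * sn k c <= e2 * (Num.sqrt k)^-1 by rewrite ler_pM2l.
have -> : (Num.sqrt k)^-1 = sn k t * (K - 1).
  by rewrite /K; field; rewrite !gt_eqF.
by have := mulr_gt0 e20 st; lra.
Qed.

End Weights.

(** * Variance maximizers *)

Section DiscreteProbability.
Context {R : realType} {disp : measure_display} {T : measurableType disp}.

Lemma discrete_probability (N : nat) (x : 'I_N -> T) (l : 'I_N -> R) :
  (forall i, 0 <= l i) -> \sum_i l i = 1 ->
  exists nu : probability T R,
    (forall A : set T, (forall i, A (x i)) -> nu A = 1%E) /\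
    (forall f : T -> \bar R, measurable_fun setT f ->
      (forall t, 0 <= f t)%E ->
      (\int[nu]_t f t = \sum_i (l i)%:E * f (x i))%E).
Proof.
move=> l0 l1.
have N0 : (0 < N)%N.
  case: N x l l0 l1 => // x l _; rewrite big_ord0 => /eqP.
  by rewrite eq_sym oner_eq0.
pose x0 := x (Ordinal N0).
(* [msum] sums a sequence indexed by [nat], hence the extension by [x0] with weight [0]; only the
   first [N] terms count. *)
pose y n := if insub n is Some i then x i else x0.
pose w n : {nonneg R} :=
  if insub n is Some i then NngNum (l0 i) else NngNum (lexx (0 : R)).
have yE (i : 'I_N) : y i = x i by rewrite /y valK.
have wE (i : 'I_N) : (w i)%:num = l i by rewrite /w valK.
pose m n : {measure set T -> \bar R} := mscale (w n) (\d_(y n)).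
pose mu : {measure set T -> \bar R} := msum m N.
have muA A : (forall i, A (x i)) -> mu A = 1%E.
  move=> Ax; rewrite /mu /= /msum /m/= /mscale.
  rewrite (eq_bigr (fun i => (l i)%:E)); first by rewrite sumEFin l1.
  by move=> i _; rewrite wE yE /= /dirac indicE mem_set// mule1.
have muT : mu setT = 1%E by exact: muA.
pose nu : probability T R := HB.pack_for (probability T R) (Measure.sort mu)
  (Measure_isProbability.Build _ _ _ (Measure.sort mu) muT).
exists nu; split; first exact: muA.
move=> f mf f0; rewrite /nu/=.
rewrite (ge0_integral_measure_sum m)//; apply: eq_bigr => i _.
rewrite ge0_integral_mscale//= wE integral_dirac//.
by rewrite diracE in_setT mul1e yE.
Qed.

End DiscreteProbability.

(** * Borel measurability and the integral inequalities for a maximizer *)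

Section VarianceMaximizer.
Context {R : realType} {disp : measure_display} {M : measurableType disp}.
Variables (d : M -> M -> R) (k : R) (X : set M).
Hypothesis Hborel : @measurable disp M = <<s [set A | mopen d A] >>.
Hypotheses (Hcat : CAT d k) (HXne : X !=set0) (HX : mcompact d X).
Local Notation d_ge0 := (dist_ge0 d k Hcat).
Local Notation rad := (circumradius d X).

Lemma mopen_measurable (A : set M) : mopen d A -> measurable A.
Proof. by move=> oA; rewrite Hborel; exact: sub_sigma_algebra. Qed.

Lemma dist_measurable z : measurable_fun setT (d^~ z).
Proof.
move=> mT; apply: (measurability _ (RGenInftyO.measurableE R)) => //.
move=> _ [_ [r ->] <-]; rewrite setTI; apply: mopen_measurable.
have -> : d^~ z @^-1` `]-oo, r[ = [set x | d x z < r].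
  by apply/seteqP; split => x /=; rewrite in_itv.
exact: (ball_mopen d k Hcat).
Qed.

Lemma sqr_dist_measurable z (A : set M) : measurable_fun A (fun x => (d x z ^+ 2)%:E).
Proof.
apply: measurable_funTS; apply/measurable_EFinP.
by apply: measurable_funX; exact: dist_measurable.
Qed.

Lemma measurable_point (p : M) : measurable [set p].
Proof.
rewrite -[X in measurable X]setCK; apply: measurableC; apply: mopen_measurable.
move=> x /= xp; exists (d x p).
  by rewrite lt_def d_ge0 andbT; apply/eqP => /(dist0_eq d k Hcat).
by move=> y xy yp; rewrite yp ltxx in xy.
Qed.

Hypothesis Hrad : lt_Dk k (2 * rad).

(** The minimax weights define a probability on [X] of variance at least [rad ^+ 2 - e], which the
    maximizer dominates; [z] competes in the infimum defining [Var d mu]. *)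
Lemma var_maximizer_ge (mu : probability M R) y z : 0 < rad ->
  circumcenter d X y -> var_maximizer d X mu ->
  ((rad ^+ 2)%:E <= \int[mu]_x (d x z ^+ 2)%:E)%E.
Proof.
move=> r0 yP [muX mumax]; apply/lee_addgt0Pr => e e0.
have [N [x [l [xX l0 l1 lP]]]] : exists N (x : 'I_N -> M) (l : 'I_N -> R),
    [/\ forall i, X (x i), forall i, 0 <= l i, \sum_i l i = 1 &
      forall z, rad ^+ 2 - e <= \sum_i l i * d (x i) z ^+ 2].
  have [k0|k0] := leP k 0.
  - exact: (variance_weights_npos d k X Hcat HXne HX y e).
  - exact: (variance_weights_pos d k X Hcat HXne HX Hrad y e).
have [nu [nuX nuI]] := discrete_probability N x l l0 l1.
apply: (@le_trans _ _ (Var d mu + e%:E)%E); last first.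
  by rewrite leeD2r//; apply: ereal_inf_lbound; exists z.
apply: (@le_trans _ _ (Var d nu + e%:E)%E); last first.
  by rewrite leeD2r//; apply: mumax; exact: nuX.
rewrite -leeBlDr//; apply: le_ereal_inf_tmp => _ [u _ <-].
rewrite nuI; first last.
- by move=> t; rewrite lee_fin sqr_ge0.
- exact: sqr_dist_measurable.
under eq_bigr do rewrite -EFinM.
by rewrite sumEFin -EFinB lee_fin lP.
Qed.

(** The integral is split at the atom; on its complement the distance is at most [B] almost
    everywhere. Splitting by points, not indices, allows repetitions among the [x i]. *)
Lemma integral_sqr_dist_le (mu : probability M R) n (x : 'I_n.+1 -> M) i z B :
  mu (range x) = 1%E -> (forall i, X (x i)) -> 0 <= B ->
  (forall x, X x -> d x z <= B) ->
  (\int[mu]_t (d t z ^+ 2)%:E <= (fine (mu [set x i]) * d (x i) z ^+ 2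
    + (1 - fine (mu [set x i])) * B ^+ 2)%:E)%E.
Proof.
move=> mux xX B0 XB; set p := x i.
have mp : measurable [set p] by exact: measurable_point.
have mcp : measurable (~` [set p]) by exact: measurableC.
have mr : measurable (range x).
  have -> : range x = \bigcup_i [set x i].
    by apply/seteqP; split => [_ [j _ <-]|_ [j _ /= ->]]; exists j.
  by apply: fin_bigcup_measurable => // j _; exact: measurable_point.
have muCr : mu (~` range x) = 0%E by rewrite probability_setC// mux subee.
have muCp : mu (~` [set p]) = (1 - fine (mu [set p]))%:E.
  by rewrite probability_setC// EFinB fineK ?fin_num_measure.
rewrite -(setUv [set p]) ge0_integral_setU//; first last.
- by apply/disj_set2P; rewrite setICr.
- by move=> t _; rewrite lee_fin sqr_ge0.
- exact: sqr_dist_measurable.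
rewrite EFinD; apply: leeD.
- rewrite (eq_integral (cst (d p z ^+ 2)%:E)); last first.
    by move=> t; rewrite inE => ->.
  rewrite integral_cst//= (EFinM (fine _)) fineK ?fin_num_measure//.
  by rewrite muleC.
- apply: (@le_trans _ _ (\int[mu]_(t in ~` [set p]) (cst (B ^+ 2)%:E t))%E).
    apply: ae_ge0_le_integral => //.
    + by move=> t _; rewrite lee_fin sqr_ge0.
    + exact: sqr_dist_measurable.
    + by move=> t _; rewrite lee_fin sqr_ge0.
    exists (~` range x); split; first exact: measurableC.
      exact: muCr.
    apply: subsetC => _ [j _ <-] _.
    by rewrite lee_fin ler_sqr ?nnegrE ?d_ge0// XB.
  by rewrite integral_cst// (EFinM (1 - _)) muleC -muCp.
Qed.

(** By subadditivity the [n + 1] masses sum to at least [1], so the largest is at least the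
    average. *)
Lemma heavy_point (mu : probability M R) n (x : 'I_n.+1 -> M) :
  mu (range x) = 1%E -> exists i, n.+1%:R^-1 <= fine (mu [set x i]).
Proof.
move=> mux.
pose a i := fine (mu [set x i]).
pose A j := [set x (inord j)].
have mA j : measurable (A j) by exact: measurable_point.
have bigA : \big[setU/set0]_(j < n.+1) A j = range x.
  rewrite -bigcup_mkord; apply/seteqP; split => [_ [j _ /= ->]|_ [j _ <-]].
    by exists (inord j).
  by exists (j : nat) => //=; rewrite /A inord_val.
have : (mu (range x) <= \sum_(j < n.+1) mu (A j))%E.
  by rewrite -bigA; exact: Boole_inequality.
rewrite mux (eq_bigr (fun j => (a j)%:E)); last first.
  move=> j _; rewrite /A inord_val /a fineK ?fin_num_measure//.
  exact: measurable_point.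
rewrite sumEFin.
rewrite lee_fin => a1.
have [j _ jmax] := @arg_maxP _ _ _ ord0 xpredT a isT.
exists j; rewrite -/(a j) -div1r ler_pdivrMr// (le_trans a1)//.
apply: (@le_trans _ _ (\sum_(i < n.+1) a j)).
  by apply: ler_sum => i _; exact: jmax.
by rewrite sumr_const card_ord mulr_natr.
Qed.

End VarianceMaximizer.

(** * The circumcenter and the two diameter bounds *)

Theorem theorem4p2 (R : realType) (k : R)
  (disp : measure_display) (M : measurableType disp) (d : M -> M -> R)
  (Hborel : @measurable disp M = <<s [set A | mopen d A] >>)
  (Hcat : CAT d k) (Hcomplete : mcomplete d)
  (X : set M) (HXne : X !=set0) (HX : mcompact d X)
  (Hball : 0 < k -> exists c (r : R),
      r < pi / (2 * Num.sqrt k) /\ X `<=` [set x | d c x < r])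
  (Y : set M) (HY : mcompact d Y)
  (Hbar : forall mu : probability M R, probX X mu ->
            forall z, barycenter d mu z -> Y z) :
  (exists! y, circumcenter d X y) /\
  S_inf (circumradius d X) k <= diameter d X /\
  (forall n : nat, (1 <= n)%N ->
     (exists mu : probability M R, var_maximizer d X mu /\ supported_on_pts X n mu) ->
     S_fun (circumradius d X) n k <= diameter d X).
Proof.
have Hrad := circumradius_lt_Dk d k X Hcat HXne HX Hball.
have [y yP] := circumcenter_exists d k X Hcat HXne HX Hrad Hcomplete.
split.
  exists y; split => // z zP.
  exact: (circumcenter_uniq d k X Hcat HXne HX Hrad).
have rad0 := circumradius_ge0 d k X Hcat HXne HX.
have [_ D0 /(_ y yP) Dr] := diameter_bounds d k X Hcat HXne HX.
set r := circumradius d X in Hrad rad0 Dr *.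
set D := diameter d X in D0 Dr *.
(* Both bounds unfold to [jung]; for [r = 0] the required inequality is trivial. *)
have Sle c : 0 <= c -> (0 < r -> c ^+ 2 * sn k r ^+ 2 <= md k D / 2) ->
    jung k c r <= D.
  move=> c0 h; apply: jung_le => //.
  move: rad0; rewrite le_eqVlt => /predU1P[<-|//].
  by rewrite sn0 expr0n mulr0 divr_ge0// md_ge0.
split.
  apply: Sle; first exact: sqrtr_ge0.
  move=> r0; rewrite sqr_sqrtr ?invr_ge0//.
  have [p Xp yp] := circumradius_attained d k X Hcat HXne HX y.
  have py : d p y = r by apply/eqP; rewrite eq_le yp yP.
  have := first_variation d k X Hcat HXne HX Hrad y p 0 r0 yP Xp py.
  rewrite lexx ltr01 => /(_ isT) h.
  suff : sn k r ^+ 2 <= md k D * (1 - 0) by lra.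
  (* For [l = 0] the condition says that a ball containing [X] has radius at least [r]. *)
  apply: h => z B B0 XB; rewrite mul0r add0r subr0 mul1r.
  rewrite ler_sqr ?nnegrE//; exact: (circumradius_le d k X Hcat HXne HX z).
move=> n n0 [mu [mumax [x [xX mux]]]].
apply: Sle; first exact: sqrtr_ge0.
move=> r0; rewrite sqr_sqrtr ?divr_ge0//.
have [i li] := heavy_point d k Hborel Hcat mu n x mux.
set l := fine (mu [set x i]) in li.
have crit z B : 0 <= B -> (forall x, X x -> d x z <= B) ->
    r ^+ 2 <= l * d (x i) z ^+ 2 + (1 - l) * B ^+ 2.
  move=> B0 XB; rewrite -lee_fin.
  apply: le_trans (var_maximizer_ge d k X Hborel Hcat HXne HX Hrad mu y z r0 yP mumax) _.
  exact: (integral_sqr_dist_le d k X Hborel Hcat mu n x i z B).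
have n10 : 0 < (n.+1%:R : R)^-1 by rewrite invr_gt0.
have l0 : 0 < l by exact: lt_le_trans li.
(* If [l = 1], the right side of [crit] vanishes at [z = x i], although [0 < r ^+ 2]. *)
have l1 : l < 1.
  have lle1 : l <= 1.
    rewrite -lee_fin /l fineK ?fin_num_measure ?probability_le1//;
      exact: (measurable_point d k Hborel Hcat).
  rewrite lt_neqAle lle1 andbT; apply/eqP => l1.
  have [DP _ _] := diameter_bounds d k X Hcat HXne HX.
  have := crit (x i) D D0 (fun u Xu => DP u (x i) Xu (xX i)).
  rewrite l1 (distxx d k Hcat); have : 0 < r ^+ 2 by rewrite exprn_gt0.
  by lra.
(* Testing [crit] at [z = y] with [B = r] puts the atom at distance exactly [r] from [y]. *)
have py : d (x i) y = r.
  apply/eqP; rewrite eq_le yP//=.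
  have := crit y r rad0 yP => h.
  have : l * r ^+ 2 <= l * d (x i) y ^+ 2 by lra.
  by rewrite ler_pM2l// ler_sqr ?nnegrE// (dist_ge0 d k Hcat).
have := first_variation d k X Hcat HXne HX Hrad y (x i) l r0 yP (xX i) py.
rewrite l1 (ltW l0) => /(_ isT crit) h.
have n1 : 0 < n%:R :> R by rewrite ltr0n.
have h1 : md k D * (1 - l) <= md k D * (n%:R / n.+1%:R).
  apply: ler_wpM2l; first exact: md_ge0.
  have -> : n%:R / n.+1%:R = 1 - n.+1%:R^-1 :> R.
    by rewrite -natr1; field; rewrite natr1 pnatr_eq0.
  by rewrite lerD2l lerN2.
have {h h1}h := le_trans h h1.
have -> : n.+1%:R / (2 * n%:R) * sn k r ^+ 2 = (n.+1%:R / n%:R) * sn k r ^+ 2 / 2.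
  by field; rewrite gt_eqF.
rewrite ler_pM2r ?invr_gt0//.
have := ler_wpM2l (ltW (divr_gt0 (ltr0Sn R n) n1)) h.
have -> : n.+1%:R / n%:R * (md k D * (n%:R / n.+1%:R)) = md k D.
  by rewrite -natr1; field; rewrite natr1 !pnatr_eq0 -!lt0n.
by [].
Qed.
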